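(* Let $\Omega_0$ and $\Omega_1$ be two convex $C^2_+$ subsets of $\mathbb{R}^3$, $t\in[0,1]$ and $$\Omega_t=(1-t)\Omega_0+t\Omega_1=\{(1-t)x+ty:\ x\in\Omega_0,\ y\in\Omega_1\}.$$ For $\Omega\in\{\Omega_0,\Omega_1,\Omega_t\}$ denote respectively by $u_0,u_1,u_t$ the admissible classical solution of $$ S_2(D^2u)=1\ \text{ in }\Omega,\qquad u=0\ \text{ on }\partial\Omega . $$ Let $v_0=-\sqrt{-u_0}$ in $\Omega_0$, $v_1=-\sqrt{-u_1}$ in $\Omega_1$, let $\tilde v_t$ be the Minkowski linear combination of $v_0$ and $v_1$, $$ \tilde v_t(x)=\inf\left\{(1-t)v_0(x_0)+t\,v_1(x_1)\,:\ x_0\in\Omega_0,\ x_1\in\Omega_1,\ x=(1-t)x_0+tx_1\right\},\qquad x\in\Omega_t, $$ and let $\tilde u_t=-\tilde v_t^{\,2}$. Then $$ u_t\leq\tilde u_t\quad\text{in }\Omega_t . $$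
   Context: A $C^2_+$ set is a bounded domain in $\mathbb{R}^3$ whose boundary is of class $C^2$ with strictly positive Gauss curvature at every point. For a real symmetric $3\times 3$ matrix $A$ with eigenvalues $\lambda_1,\lambda_2,\lambda_3$, $S_1(A)=\lambda_1+\lambda_2+\lambda_3$ and $S_2(A)=\lambda_1\lambda_2+\lambda_1\lambda_3+\lambda_2\lambda_3$. A function $u\in C^2(\Omega)$ is admissible (or $2$-convex) if $S_1(D^2u(x))>0$ and $S_2(D^2u(x))>0$ for every $x\in\Omega$. An admissible classical solution is an admissible function in $C^2(\Omega)\cap C(\overline\Omega)$ satisfying the equation and boundary condition; such a solution is negative in $\Omega$. *)

(* Defs.v *)
From HB Require Import structures.
From mathcomp Require Export all_boot all_order all_algebra.
From mathcomp Require Export all_classical all_reals all_analysis.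
Export numFieldNormedType.Exports.

Set Implicit Arguments.
Unset Strict Implicit.
Unset Printing Implicit Defensive.

Import Order.TTheory GRing.Theory Num.Theory.

Local Open Scope classical_set_scope.
Local Open Scope ring_scope.

Definition boundary (T : topologicalType) (A : set T) : set T :=
  closure A `\` interior A.

Definition partial (R : realType) (n : nat) (W : normedModType R) (i : 'I_n.+1)
    (f : 'rV[R]_n.+1 -> W) (x : 'rV[R]_n.+1) : W :=
  'D_(delta_mx 0 i) f x.

(* All partial derivatives of order at most [k] exist and are continuous at
   the points of [A]; the definition is meant for an open [A]. *)
Fixpoint class_C (R : realType) (n : nat) (k : nat) (A : set 'rV[R]_n.+1)
    (f : 'rV[R]_n.+1 -> R) : Prop :=
  (forall x, A x -> {for x, continuous f}) /\
  match k with
  | 0 => True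
  | k'.+1 => forall i : 'I_n.+1,
      (forall x, A x -> derivable f x (delta_mx 0 i)) /\
      class_C k' A (partial i f)
  end.

Definition hessian (R : realType) (n : nat) (f : 'rV[R]_n.+1 -> R)
    (x : 'rV[R]_n.+1) : 'M[R]_n.+1 :=
  \matrix_(i, j) partial i (partial j f) x.

(* The eigenvalues of [A], repeated according to their algebraic multiplicity
   and listed in an arbitrary order.  The list exists as soon as [A] is
   symmetric; only symmetric functions of it are used below. *)
Definition eigenvalues (R : realType) (n : nat) (A : 'M[R]_n) : 'rV[R]_n :=
  xget 0 [set l : 'rV[R]_n | char_poly A = \prod_(i < n) ('X - (l 0 i)%:P)].

Definition S1 (R : realType) (A : 'M[R]_3) : R :=
  \sum_(i < 3) eigenvalues A 0 i.

Definition S2 (R : realType) (A : 'M[R]_3) : R :=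
  \sum_(i < 3) \sum_(j < 3 | (i < j)%N) eigenvalues A 0 i * eigenvalues A 0 j.

Definition dotprod (R : realType) (n : nat) (u v : 'rV[R]_n) : R :=
  \sum_(i < n) u 0 i * v 0 i.

(* The additions of indices are those of 'I_3, i.e. modulo 3. *)
Definition crossprod (R : realType) (u v : 'rV[R]_3) : 'rV[R]_3 :=
  \row_(k < 3) (u 0 (k + 1) * v 0 (k + 2%:R) - u 0 (k + 2%:R) * v 0 (k + 1)).

(* Gauss curvature at [s] of the surface parametrized by [X]: the quotient of
   the determinants of the second and of the first fundamental forms. *)
Definition gauss_curvature (R : realType) (X : 'rV[R]_2 -> 'rV[R]_3)
    (s : 'rV[R]_2) : R :=
  let Xd i := partial i X s in
  let Xdd i j := partial i (partial j X) s in
  let m := crossprod (Xd 0) (Xd 1) in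
  let N := (Num.sqrt (dotprod m m))^-1 *: m in
  let I : 'M[R]_2 := \matrix_(i, j) dotprod (Xd i) (Xd j) in
  let II : 'M[R]_2 := \matrix_(i, j) dotprod (Xdd i j) N in
  \det II / \det I.

(* The graph of [g], placed in R^3 by means of the orthogonal matrix [Q]. *)
Definition graph_param (R : realType) (Q : 'M[R]_3) (g : 'rV[R]_2 -> R)
    (s : 'rV[R]_2) : 'rV[R]_3 :=
  (row_mx s (g s)%:M : 'rV[R]_(2 + 1)) *m Q.

Definition above_graph (R : realType) (Q : 'M[R]_3) (g : 'rV[R]_2 -> R) :
    set 'rV[R]_3 :=
  [set x | let y : 'rV[R]_(2 + 1) := x *m Q^T in g (lsubmx y) < rsubmx y 0 0].

(* Near each boundary point, up to an orthogonal change of coordinates, the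
   set is the part of space above the graph of a C^2 function, and the
   boundary is that graph; the Gauss curvature of the boundary does not depend
   on the chosen coordinates. *)
Definition C2_plus (R : realType) (Omega : set 'rV[R]_3) : Prop :=
  [/\ Omega !=set0, open Omega, connected Omega, bounded_set Omega &
    forall p, boundary Omega p ->
      exists (Q : 'M[R]_3) (g : 'rV[R]_2 -> R) (s : 'rV[R]_2),
        [/\ Q *m Q^T = 1%:M,
            class_C 2 setT g,
            \forall x \near p, Omega x <-> above_graph Q g x,
            graph_param Q g s = p &
            0 < gauss_curvature (graph_param Q g) s]].

Definition admissible (R : realType) (Omega : set 'rV[R]_3)
    (u : 'rV[R]_3 -> R) : Prop :=
  class_C 2 Omega u /\
  forall x, Omega x -> 0 < S1 (hessian u x) /\ 0 < S2 (hessian u x).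

Definition admissible_solution (R : realType) (Omega : set 'rV[R]_3)
    (u : 'rV[R]_3 -> R) : Prop :=
  [/\ admissible Omega u,
      {within closure Omega, continuous u},
      forall x, Omega x -> S2 (hessian u x) = 1 &
      forall x, boundary Omega x -> u x = 0].

Definition minkowski_comb (R : realType) (t : R) (A B : set 'rV[R]_3) :
    set 'rV[R]_3 :=
  [set (1 - t) *: x + t *: y | x in A & y in B].

Definition minkowski_comb_fun (R : realType) (t : R) (A B : set 'rV[R]_3)
    (v w : 'rV[R]_3 -> R) (x : 'rV[R]_3) : R :=
  inf [set r | exists x0 x1, [/\ A x0, B x1, x = (1 - t) *: x0 + t *: x1 &
                                 r = (1 - t) * v x0 + t * w x1]].

(* Main.v *)
Require Import Defs.
From mathcomp Require Import ring lra.

(** Put v = - sqrt (- u) and, at a point of the domain, a = - v, th = grad v and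
    A = D^2 v.  Then D^2 u = 2 (a A - th^T th), so the equation reads
    sigma2 (a A - th^T th) = 1/4, where sigma2 is the second elementary
    symmetric function of the eigenvalues.  The theorem amounts to
      v_t ((1 - t) x + t y) <= (1 - t) v_0 x + t v_1 y
    for x in Omega_0 and y in Omega_1: take the infimum over the decompositions
    of a point, and then square.  For t = 0 or 1 it follows from the case t = 1/2
    with equal domains [solution_unique_le]; from now on 0 < t < 1.

    Suppose that this fails.  Maximise
      v_t (sum_i l_i ((1 - t) x_i + t y_i))
        - sum_i l_i ((1 - t) v_0 (x_i) + t v_1 (y_i))
    over weights l_0, ..., l_4 of sum 1 and points x_i, y_i of the closures;
    this compares v_t with the Minkowski combination of the convex envelopes of
    v_0 and v_1.  The maximum exists by compactness [exists_max_gap] and is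
    positive.
    - Near a boundary point the domain contains a ball tangent to the boundary
      [C2_plus_interior_ball]; as the Laplacian of u exceeds 1, a quadratic
      barrier shows that - u grows at least linearly there, so v has infinite
      slope [root_steep].  Hence every point of positive weight is interior
      [max_gap_interior].
    - The first variation says that all the gradients equal th = grad v_t; the
      second one says that A_t [sum mu xi] <= sum mu A [xi] for all choices of
      the directions xi [max_gap_variation, max_gap_gradient].
    - By Caratheodory's argument one weight may be taken to be 0.  That slot
      can be used to split any other point into two nearby ones, and maximality
      then gives A >= 0 at every point of positive weight [max_gap_psd].

    It remains to see that these data force sum mu a <= a_t, which contradicts
    positivity [sigma2_parallel_sum].  The second-order condition says that
    A_t <= B, where B is the parallel sum (sum mu A^-1)^-1.  Since sigma2 is
    increasing on its cone of admissible matrices, sigma2 (a_t B - th^T th) is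
    at least 1/4.  On the other hand, the set of the pairs (a, C) with C
    positive definite and sigma2 (a C^-1 - th^T th) <= 1/4 is a convex cone
    [dual_coneD], so (sum mu a, sum mu A^-1) belongs to it; if sum mu a
    exceeded a_t this would be incompatible with the lower bound.

    The convexity of that cone is the algebraic core.  Split C along th as
    [x c; c^T K], with K a 2 x 2 matrix, and put tau = |th|^2.  After clearing
    determinants the inequality is linear in x, and it says
      x >= a^2 / psi + c^T W^-1 c,
      psi = a tau + det K / (4 tr K) - a^2 / tr K,
      W = 4 Y - (4 tau^2 + 1) a^2 Y / det Y,   Y = a tau I + K / 4.
    The right-hand side is a subadditive function of (a, c, K), because psi
    and the quadratic form of W are superadditive; both facts come down to the
    superadditivity of det M / n for 2 x 2 matrices M, when n is the trace of M
    or the value of its form at a fixed vector. *)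

Set Implicit Arguments.
Unset Strict Implicit.
Unset Printing Implicit Defensive.
Import Order.TTheory GRing.Theory Num.Theory.
Local Open Scope classical_set_scope.
Local Open Scope ring_scope.

(** * Superadditivity for planar quadratic forms *)

Section ScalarCone.
Variable R : realFieldType.
Implicit Types a b c d e f g h k l m n p q r s t x y z : R.

Lemma sqr_over_subadd a b s t : 0 < s -> 0 < t ->
  (a + b) ^+ 2 / (s + t) <= a ^+ 2 / s + b ^+ 2 / t.
Proof.
move=> s0 t0; have st0 : 0 < s + t by exact: addr_gt0.
rewrite -subr_ge0.
have -> : a ^+ 2 / s + b ^+ 2 / t - (a + b) ^+ 2 / (s + t) =
    (a * t - b * s) ^+ 2 / (s * t * (s + t)).
  by field; rewrite ?gt_eqF.
by rewrite divr_ge0 ?sqr_ge0// ltW// !mulr_gt0.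
Qed.

(** By the Cayley-Hamilton theorem, det M |p|^2 = tr M (p^T M p) - |M p|^2 for a
    planar symmetric M. *)
Lemma det2_isotropic k l m p q : 0 < p ^+ 2 + q ^+ 2 ->
  k * p ^+ 2 + 2 * m * p * q + l * q ^+ 2 = 0 -> k * l - m ^+ 2 <= 0.
Proof.
move=> pq0 iso; rewrite -(pmulr_lle0 _ pq0) mulrC.
have -> : (p ^+ 2 + q ^+ 2) * (k * l - m ^+ 2) =
    (l + k) * (k * p ^+ 2 + 2 * m * p * q + l * q ^+ 2)
    - (m * p + l * q) ^+ 2 - (k * p + m * q) ^+ 2 by ring.
rewrite iso mulr0; have := sqr_ge0 (m * p + l * q).
by have := sqr_ge0 (k * p + m * q); lra.
Qed.

Lemma det2_traceless k m : k * - k - m ^+ 2 <= 0.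
Proof. by have := sqr_ge0 k; have := sqr_ge0 m; lra. Qed.

(** The defect of superadditivity of det M / n is
    - det (n' M - n M') / (n n' (n + n')), so all that matters is that
    n' M - n M' is not definite.  It has an isotropic vector when n is the value
    of the form at that vector, and it is traceless when n is the trace. *)
Lemma det2_ratio_superadd k l m n k' l' m' n' :
  0 < n -> 0 < n' ->
  (n' * k - n * k') * (n' * l - n * l') - (n' * m - n * m') ^+ 2 <= 0 ->
  (k * l - m ^+ 2) / n + (k' * l' - m' ^+ 2) / n' <=
  ((k + k') * (l + l') - (m + m') ^+ 2) / (n + n').
Proof.
move=> n0 n0' h; have nn0 : 0 < n + n' by exact: addr_gt0.
rewrite -subr_ge0.
have -> : ((k + k') * (l + l') - (m + m') ^+ 2) / (n + n')
   - ((k * l - m ^+ 2) / n + (k' * l' - m' ^+ 2) / n') =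
   - ((n' * k - n * k') * (n' * l - n * l') - (n' * m - n * m') ^+ 2)
   / (n * n' * (n + n')).
  by field; rewrite ?gt_eqF.
by rewrite divr_ge0 ?oppr_ge0// ltW// !mulr_gt0.
Qed.

Lemma det2_form_superadd p q k l m k' l' m' :
  let n k l m := k * p ^+ 2 + 2 * m * p * q + l * q ^+ 2 in
  0 < n k l m -> 0 < n k' l' m' ->
  (k * l - m ^+ 2) / n k l m + (k' * l' - m' ^+ 2) / n k' l' m' <=
  ((k + k') * (l + l') - (m + m') ^+ 2) / n (k + k') (l + l') (m + m').
Proof.
move=> n n0 n0'.
have -> : n (k + k') (l + l') (m + m') = n k l m + n k' l' m' by rewrite /n; ring.
apply: det2_ratio_superadd => //; apply: (@det2_isotropic _ _ _ p q).
  rewrite lt_neqAle addr_ge0 ?sqr_ge0// andbT eq_sym paddr_eq0 ?sqr_ge0//.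
  rewrite !sqrf_eq0; apply/negP => /andP[/eqP p0 /eqP q0].
  by move: n0; rewrite /n p0 q0; lra.
by rewrite /n; ring.
Qed.

Lemma det2_trace_superadd k l m k' l' m' :
  0 < k + l -> 0 < k' + l' ->
  (k * l - m ^+ 2) / (k + l) + (k' * l' - m' ^+ 2) / (k' + l') <=
  ((k + k') * (l + l') - (m + m') ^+ 2) / ((k + l) + (k' + l')).
Proof.
move=> n0 n0'; apply: det2_ratio_superadd => //.
have -> : (k' + l') * l - (k + l) * l' = - ((k' + l') * k - (k + l) * k') by ring.
exact: det2_traceless.
Qed.

(** With K = [k m; m l], the number a^2 / psi is the least x for which
    the diagonal block matrix with blocks x and K lies in the cone, if psi > 0. *)
Definition psi tau a k l m :=
  a * tau + (k * l - m ^+ 2) / (k + l) / 4 - a ^+ 2 / (k + l).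

Lemma psi_superadd tau a k l m a' k' l' m' : 0 < k + l -> 0 < k' + l' ->
  psi tau a k l m + psi tau a' k' l' m' <=
  psi tau (a + a') (k + k') (l + l') (m + m').
Proof.
move=> T0 T0'; rewrite /psi.
have -> : k + k' + (l + l') = (k + l) + (k' + l') by ring.
have := @det2_trace_superadd k l m k' l' m' T0 T0'.
have := @sqr_over_subadd a a' _ _ T0 T0'.
by rewrite mulrDl; lra.
Qed.

(** c^T adj(Y) c / phi, for Y = [y w; w z]. *)
Definition quot phi c d y z w :=
  (z * c ^+ 2 - 2 * w * c * d + y * d ^+ 2) / phi.

(** Legendre duality: [quot] is c^T W^-1 c for W = (phi / det Y) Y, which is the
    maximum over p of 2 c.p - p^T W p. *)
Lemma quot_dual phi c d y z w p q :
  0 < phi -> 0 < y -> 0 < y * z - w ^+ 2 ->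
  2 * (c * p + d * q)
    - phi * ((y * p ^+ 2 + 2 * w * p * q + z * q ^+ 2) / (y * z - w ^+ 2))
  <= quot phi c d y z w.
Proof.
move=> phi0 y0 D0; rewrite /quot -subr_ge0; set D := y * z - w ^+ 2 in D0 *.
pose u := c - (y * p + w * q) * phi / D.
pose v := d - (w * p + z * q) * phi / D.
have -> : (z * c ^+ 2 - 2 * w * c * d + y * d ^+ 2) / phi -
   (2 * (c * p + d * q)
    - phi * ((y * p ^+ 2 + 2 * w * p * q + z * q ^+ 2) / D)) =
   (z * u ^+ 2 - 2 * w * u * v + y * v ^+ 2) / phi.
  by rewrite /u /v /D; field; rewrite ?gt_eqF.
rewrite divr_ge0 ?(ltW phi0)//.
rewrite -(pmulr_lge0 _ y0).
have -> : (z * u ^+ 2 - 2 * w * u * v + y * v ^+ 2) * y =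
   D * u ^+ 2 + (y * v - w * u) ^+ 2 by rewrite /D; ring.
by rewrite addr_ge0 ?sqr_ge0// mulr_ge0 ?sqr_ge0// ltW.
Qed.

Lemma form2_gt0 y z w p q : 0 < y -> 0 < y * z - w ^+ 2 ->
  (p != 0) || (q != 0) -> 0 < y * p ^+ 2 + 2 * w * p * q + z * q ^+ 2.
Proof.
move=> y0 D0 pq; rewrite -(pmulr_lgt0 _ y0).
have -> : (y * p ^+ 2 + 2 * w * p * q + z * q ^+ 2) * y =
   (y * p + w * q) ^+ 2 + (y * z - w ^+ 2) * q ^+ 2 by ring.
have [q0|q0] := eqVneq q 0; last first.
  by rewrite ltr_wpDl ?sqr_ge0// mulr_gt0// exprn_even_gt0.
rewrite q0 eqxx orbF in pq *.
by rewrite expr0n/= !mulr0 !addr0 exprn_even_gt0//= mulf_neq0// gt_eqF.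
Qed.

(** Here W = (phi / det Y) Y = 4 Y - kap a^2 Y / det Y.  At a fixed vector p the
    form of a^2 Y / det Y is a^2 / (det Y / p^T Y p), which is subadditive in
    (a, Y) since det Y / p^T Y p is superadditive.  Thus the form of W is
    superadditive, and by duality c^T W^-1 c is subadditive. *)
Lemma quot_subadd kap a c d y z w a' c' d' y' z' w' :
  let phi a y z w := 4 * (y * z - w ^+ 2) - kap * a ^+ 2 in
  0 <= kap ->
  0 < y -> 0 < y * z - w ^+ 2 -> 0 < y' -> 0 < y' * z' - w' ^+ 2 ->
  0 < phi a y z w -> 0 < phi a' y' z' w' ->
  0 < phi (a + a') (y + y') (z + z') (w + w') ->
  0 < (y + y') * (z + z') - (w + w') ^+ 2 ->
  quot (phi (a + a') (y + y') (z + z') (w + w'))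
    (c + c') (d + d') (y + y') (z + z') (w + w') <=
  quot (phi a y z w) c d y z w + quot (phi a' y' z' w') c' d' y' z' w'.
Proof.
move=> phi kap0 y0 D0 y0' D0' phi0 phi0' phi0'' D0''.
set Y := y + y'; set Z := z + z'; set W := w + w'; set C := c + c'; set D := d + d'.
have [/eqP|CD] := eqVneq (C ^+ 2 + D ^+ 2) 0.
  rewrite paddr_eq0 ?sqr_ge0// !sqrf_eq0 => /andP[/eqP-> /eqP->].
  have := @quot_dual (phi a y z w) c d y z w 0 0 phi0 y0 D0.
  have := @quot_dual (phi a' y' z' w') c' d' y' z' w' 0 0 phi0' y0' D0'.
  by rewrite /quot !(expr0n, mulr0, mul0r, addr0, subr0) /=; lra.
set F := phi (a + a') Y Z W in phi0'' *.
(* the maximiser (phi / det Y)^-1 Y^-1 c of the dual problem for the sum *)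
pose p := (Z * C - W * D) / F; pose q := (Y * D - W * C) / F.
have := @quot_dual (phi a y z w) c d y z w p q phi0 y0 D0.
have := @quot_dual (phi a' y' z' w') c' d' y' z' w' p q phi0' y0' D0'.
have -> : quot F C D Y Z W = 2 * (C * p + D * q) -
    F * ((Y * p ^+ 2 + 2 * W * p * q + Z * q ^+ 2) / (Y * Z - W ^+ 2)).
  by rewrite /p /q /quot; field; rewrite !gt_eqF.
have pq0 : (p != 0) || (q != 0).
  apply: contraT; rewrite negb_or !negbK => /andP[].
  rewrite /p /q !mulf_eq0 invr_eq0 (gt_eqF phi0'') !orbF => /eqP e1 /eqP e2.
  have : (Y * Z - W ^+ 2) * C == 0.
    have -> : (Y * Z - W ^+ 2) * C = Y * (Z * C - W * D) + W * (Y * D - W * C) by ring.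
    by rewrite e1 e2 !mulr0 addr0.
  have : (Y * Z - W ^+ 2) * D == 0.
    have -> : (Y * Z - W ^+ 2) * D = W * (Z * C - W * D) + Z * (Y * D - W * C) by ring.
    by rewrite e1 e2 !mulr0 addr0.
  rewrite !mulf_eq0 (gt_eqF D0'')/= => /eqP d0 /eqP c0.
  by move: CD; rewrite c0 d0 expr0n/= addr0 eqxx.
have n0 := @form2_gt0 y z w p q y0 D0 pq0.
have n0' := @form2_gt0 y' z' w' p q y0' D0' pq0.
have sup := @det2_form_superadd p q y z w y' z' w' n0 n0'.
have r0 := divr_gt0 D0 n0; have r0' := divr_gt0 D0' n0'.
have sub := @sqr_over_subadd a a' _ _ r0 r0'.
have n0'' : 0 < Y * p ^+ 2 + 2 * W * p * q + Z * q ^+ 2.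
  have -> : Y * p ^+ 2 + 2 * W * p * q + Z * q ^+ 2 =
    (y * p ^+ 2 + 2 * w * p * q + z * q ^+ 2) +
    (y' * p ^+ 2 + 2 * w' * p * q + z' * q ^+ 2) by rewrite /Y /Z /W; ring.
  exact: addr_gt0.
have le2 : (a + a') ^+ 2 / ((Y * Z - W ^+ 2) / (Y * p ^+ 2 + 2 * W * p * q + Z * q ^+ 2))
   <= (a + a') ^+ 2 / ((y * z - w ^+ 2) / (y * p ^+ 2 + 2 * w * p * q + z * q ^+ 2) +
  (y' * z' - w' ^+ 2) / (y' * p ^+ 2 + 2 * w' * p * q + z' * q ^+ 2)).
  rewrite ler_wpM2l ?sqr_ge0// lef_pV2 ?posrE ?divr_gt0// addr_gt0//.
have := le_trans le2 sub.
have expand a0 y1 z1 w1 : 0 < y1 * z1 - w1 ^+ 2 ->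
   phi a0 y1 z1 w1 * ((y1 * p ^+ 2 + 2 * w1 * p * q + z1 * q ^+ 2) / (y1 * z1 - w1 ^+ 2))
   = 4 * (y1 * p ^+ 2 + 2 * w1 * p * q + z1 * q ^+ 2)
   - kap * (a0 ^+ 2 / ((y1 * z1 - w1 ^+ 2) / (y1 * p ^+ 2 + 2 * w1 * p * q + z1 * q ^+ 2))).
  move=> D1; rewrite /phi invf_div; field; rewrite gt_eqF//.
rewrite /F !expand//.
rewrite -subr_ge0 => /(mulr_ge0 kap0).
rewrite /Y /Z /W /C /D; lra.
Qed.

(** The inequality sigma2 (a C^-1 - tau E00) <= 1/4 multiplied by det C, for
    C = [x c d; c k m; d m l]: see [dual_coneP]. *)
Definition cone_ineq tau a x c d k l m :=
  a ^+ 2 * (k + l) + a * tau * (c ^+ 2 + d ^+ 2)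
    + (l * c ^+ 2 - 2 * m * c * d + k * d ^+ 2) / 4 <=
  x * (a * tau * (k + l) + (k * l - m ^+ 2) / 4 - a ^+ 2).

(** The coefficient of x is phi = (k + l) psi, and it must be positive because
    the left-hand side of [cone_ineq] is. *)
Lemma cone_ineqE tau a x c d k l m : 0 <= tau -> 0 < a -> 0 < x ->
  0 < k -> 0 < k * l - m ^+ 2 ->
  let y := a * tau + k / 4 in let z := a * tau + l / 4 in let w := m / 4 in
  let phi := 4 * (y * z - w ^+ 2) - (4 * tau ^+ 2 + 1) * a ^+ 2 in
  [/\ 0 < k + l, 0 < y, 0 < y * z - w ^+ 2, phi = (k + l) * psi tau a k l m &
  cone_ineq tau a x c d k l m <->
    0 < psi tau a k l m /\ a ^+ 2 / psi tau a k l m + quot phi c d y z w <= x].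
Proof.
move=> tau0 a0 x0 k0 D0 y z w phi.
have l0 : 0 < l.
  rewrite -(pmulr_rgt0 _ k0); have := sqr_ge0 m; lra.
have T0 : 0 < k + l by exact: addr_gt0.
have at0 : 0 <= a * tau by rewrite mulr_ge0 // ltW.
have y0 : 0 < y by rewrite /y; lra.
have Ye : y * z - w ^+ 2 = (a * tau) ^+ 2 + a * tau * (k + l) / 4 + (k * l - m ^+ 2) / 16.
  by rewrite /y /z /w; field.
have YD : 0 < y * z - w ^+ 2.
  rewrite Ye ltr_wpDl ?divr_gt0// addr_ge0 ?sqr_ge0//.
  by rewrite divr_ge0// mulr_ge0// ltW.
have phiE : phi = (k + l) * psi tau a k l m.
  by rewrite /phi Ye /psi; field; rewrite gt_eqF.
have phiE2 : phi = a * tau * (k + l) + (k * l - m ^+ 2) / 4 - a ^+ 2.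
  by rewrite /phi Ye; field.
split => //.
have ZE : a * tau * (c ^+ 2 + d ^+ 2)
    + (l * c ^+ 2 - 2 * m * c * d + k * d ^+ 2) / 4 =
    z * c ^+ 2 - 2 * w * c * d + y * d ^+ 2 by rewrite /z /w /y; field.
have Z0 : 0 <= z * c ^+ 2 - 2 * w * c * d + y * d ^+ 2.
  have -> : z * c ^+ 2 - 2 * w * c * d + y * d ^+ 2 =
     ((y * z - w ^+ 2) * c ^+ 2 + (y * d - w * c) ^+ 2) / y.
    by field; rewrite gt_eqF.
  by rewrite divr_ge0 ?(ltW y0)// addr_ge0 ?sqr_ge0// mulr_ge0 ?sqr_ge0// ltW.
rewrite /cone_ineq -phiE2 -addrA ZE; split => [h|[psi0 h]].
  have phi0 : 0 < phi.
    rewrite -(pmulr_rgt0 _ x0); apply: lt_le_trans h.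
    by rewrite ltr_wpDr// mulr_gt0// exprn_gt0.
  have psi0 : 0 < psi tau a k l m by move: phi0; rewrite phiE pmulr_rgt0.
  split => //; rewrite /quot.
  have -> : a ^+ 2 / psi tau a k l m = a ^+ 2 * (k + l) / phi.
    by rewrite phiE; field; rewrite !gt_eqF.
  by rewrite -mulrDl ler_pdivrMr.
have phi0 : 0 < phi by rewrite phiE mulr_gt0.
rewrite -ler_pdivrMr// mulrDl; apply: le_trans h; rewrite /quot lerD2r.
by rewrite phiE; rewrite le_eqVlt; apply/orP; left; apply/eqP; field; rewrite !gt_eqF.
Qed.

Lemma cone_ineq_add tau a x c d k l m a' x' c' d' k' l' m' :
  0 <= tau -> 0 < a -> 0 < x -> 0 < k -> 0 < k * l - m ^+ 2 ->
  0 < a' -> 0 < x' -> 0 < k' -> 0 < k' * l' - m' ^+ 2 ->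
  0 < (k + k') * (l + l') - (m + m') ^+ 2 ->
  cone_ineq tau a x c d k l m -> cone_ineq tau a' x' c' d' k' l' m' ->
  cone_ineq tau (a + a') (x + x') (c + c') (d + d') (k + k') (l + l') (m + m').
Proof.
move=> tau0 a0 x0 k0 D0 a0' x0' k0' D0' D0''.
have [T0 y0 Y0 pE ->] := @cone_ineqE tau a x c d k l m tau0 a0 x0 k0 D0.
have [T0' y0' Y0' pE' ->] := @cone_ineqE tau a' x' c' d' k' l' m' tau0 a0' x0' k0' D0'.
have a0'' := addr_gt0 a0 a0'; have x0'' := addr_gt0 x0 x0'.
have k0'' := addr_gt0 k0 k0'.
have [T0'' y0'' Y0'' pE'' ->] := @cone_ineqE tau _ _ (c + c') (d + d')
  _ _ _ tau0 a0'' x0'' k0'' D0''.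
move=> [psi0 h] [psi0' h'].
have sup := @psi_superadd tau a k l m a' k' l' m' T0 T0'.
have psi0'' : 0 < psi tau (a + a') (k + k') (l + l') (m + m').
  by apply: lt_le_trans sup; exact: addr_gt0.
split => //.
apply: le_trans (lerD h h'); rewrite addrACA lerD//.
  apply: le_trans (sqr_over_subadd a a' psi0 psi0').
  by rewrite ler_wpM2l ?sqr_ge0// lef_pV2 ?posrE// addr_gt0.
move: y0'' Y0'' pE''.
have -> : (a + a') * tau + (k + k') / 4 = (a * tau + k / 4) + (a' * tau + k' / 4) by field.
have -> : (a + a') * tau + (l + l') / 4 = (a * tau + l / 4) + (a' * tau + l' / 4) by field.
have -> : (m + m') / 4 = m / 4 + m' / 4 by field.
move=> y0'' Y0'' pE''.
apply: (@quot_subadd (4 * tau ^+ 2 + 1)) => //.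
- by have := sqr_ge0 tau; lra.
- by rewrite pE mulr_gt0.
- by rewrite pE' mulr_gt0.
- by rewrite pE'' mulr_gt0.
Qed.

End ScalarCone.

(** * Quadratic forms and the second elementary symmetric function *)

Section QuadForm.
Variable R : realFieldType.
Variable n : nat.
Implicit Types (A B Q : 'M[R]_n) (v w : 'rV[R]_n).

Definition qform A v : R := (v *m A *m v^T) 0 0.

Definition psd A := A^T = A /\ forall v, 0 <= qform A v.
Definition posdef A := A^T = A /\ forall v, v != 0 -> 0 < qform A v.

Lemma qformD A B v : qform (A + B) v = qform A v + qform B v.
Proof. by rewrite /qform mulmxDr mulmxDl mxE. Qed.

Lemma qformZ c A v : qform (c *: A) v = c * qform A v.
Proof. by rewrite /qform -scalemxAr -scalemxAl mxE. Qed.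

Lemma qformB A B v : qform (A - B) v = qform A v - qform B v.
Proof. by rewrite -scaleN1r qformD qformZ mulN1r. Qed.

Lemma qform0 A : qform A 0 = 0.
Proof. by rewrite /qform !mul0mx mxE. Qed.

Lemma qform_sum I (r : seq I) (P : pred I) (F : I -> 'M[R]_n) v :
  qform (\sum_(i <- r | P i) F i) v = \sum_(i <- r | P i) qform (F i) v.
Proof.
apply: (big_morph (fun A => qform A v)) => [A B|]; first exact: qformD.
by rewrite /qform mulmx0 mul0mx mxE.
Qed.

Lemma qform_conj A Q v : qform (Q^T *m A *m Q) v = qform A (v *m Q^T).
Proof. by rewrite /qform trmx_mul trmxK !mulmxA. Qed.

Lemma qform1_gt0 v : v != 0 -> 0 < qform 1%:M v.
Proof.
rewrite /qform mulmx1 mxE => v0.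
have [i vi] : exists i, v 0 i != 0.
  apply/existsP; apply: contraR v0; rewrite negb_exists => /forallP v0.
  by apply/eqP/rowP => i; rewrite mxE; apply/eqP; have := v0 i; rewrite negbK.
rewrite (bigD1 i)//= mxE ltr_pwDl//.
  by rewrite -expr2 lt_neqAle sqr_ge0 andbT eq_sym sqrf_eq0.
by rewrite sumr_ge0// => j _; rewrite mxE -expr2 sqr_ge0.
Qed.

Lemma qform1_ge0 v : 0 <= qform 1%:M v.
Proof.
have [->|/qform1_gt0/ltW//] := eqVneq v 0; by rewrite qform0.
Qed.

Lemma posdefW A : posdef A -> psd A.
Proof.
move=> [As A0]; split => // v; have [->|/A0/ltW//] := eqVneq v 0.
by rewrite qform0.
Qed.

Lemma posdefD A B : posdef A -> posdef B -> posdef (A + B).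
Proof.
move=> [As A0] [Bs B0]; split; first by rewrite linearD/= As Bs.
by move=> v v0; rewrite qformD addr_gt0// ?A0 ?B0.
Qed.

Lemma posdefZ c A : 0 < c -> posdef A -> posdef (c *: A).
Proof.
move=> c0 [As A0]; split; first by rewrite linearZ/= As.
by move=> v v0; rewrite qformZ mulr_gt0// A0.
Qed.

Lemma posdef_shift A e : psd A -> 0 < e -> posdef (A + e%:M).
Proof.
move=> [As A0] e0; split; first by rewrite linearD/= As tr_scalar_mx.
move=> v v0; rewrite qformD -[e%:M]scalemx1 qformZ ltr_wpDl// mulr_gt0//.
exact: qform1_gt0.
Qed.

Lemma posdef_unit A : posdef A -> A \in unitmx.
Proof.
move=> [_ A0]; rewrite -row_free_unit; apply: inj_row_free => v vA.
apply/eqP; apply: contraT => /A0; by rewrite /qform vA mul0mx mxE ltxx.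
Qed.

Lemma posdef_inv A : posdef A -> posdef (invmx A).
Proof.
move=> Ap; have Au := posdef_unit Ap; have [As A0] := Ap.
have Bs : (invmx A)^T = invmx A by rewrite trmx_inv As.
split => // v v0.
have -> : qform (invmx A) v = qform A (v *m invmx A).
  by rewrite /qform trmx_mul Bs mulmxKV// mulmxA.
apply: A0; apply: contra v0 => /eqP vB.
by rewrite -(mulmxKV Au v) vB mul0mx.
Qed.

Lemma psd_conj A Q : psd A -> psd (Q^T *m A *m Q).
Proof.
move=> [As A0]; split; last by move=> v; rewrite qform_conj.
by rewrite !trmx_mul trmxK As mulmxA.
Qed.

(** A form bounded by an infimal convolution is bounded by the parallel sum: the
    infimum is reached at f_i = v C^-1 A_i^-1, which the hypothesis tests. *)
Lemma qform_le_inv_sum (I : finType) (P : pred I) (mu : I -> R)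
    (A : I -> 'M[R]_n) (At C : 'M[R]_n) :
  (forall i, P i -> posdef (A i)) ->
  C = \sum_(i | P i) mu i *: invmx (A i) -> C \in unitmx -> C^T = C ->
  (forall f : I -> 'rV[R]_n,
    qform At (\sum_(i | P i) mu i *: f i)
      <= \sum_(i | P i) mu i * qform (A i) (f i)) ->
  forall v, qform At v <= qform (invmx C) v.
Proof.
move=> Ap CE Cu Cs h v; set B := invmx C.
have Bs : B^T = B by rewrite trmx_inv Cs.
have := h (fun i => v *m B *m invmx (A i)).
have -> : \sum_(i | P i) mu i *: (v *m B *m invmx (A i)) = v.
  under eq_bigr do rewrite scalemxAr.
  by rewrite -mulmx_sumr -CE mulmxKV.
move/le_trans; apply.
have -> : qform B v = qform C (v *m B).
  by rewrite /qform trmx_mul Bs mulmxKV// mulmxA.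
rewrite CE qform_sum ler_sum// => i Pi; rewrite qformZ.
have Au := posdef_unit (Ap i Pi); have [As _] := Ap i Pi.
by rewrite /qform trmx_mul trmx_inv As mulmxKV// mulmxA.
Qed.

End QuadForm.

Section Sigma2.
Variable R : realFieldType.

(** The sum of the 2 x 2 principal minors, written so that its polarisation and
    its conjugation invariance are visible.  On symmetric matrices it is a
    quadratic form of Lorentzian signature. *)
Definition sigma2 n (M : 'M[R]_n) : R := ((\tr M) ^+ 2 - \tr (M *m M)) / 2.

Lemma mxtrace_sqr_ge0 n (M : 'M[R]_n) : M^T = M -> 0 <= \tr (M *m M).
Proof.
move=> Ms; rewrite -{2}Ms /mxtrace sumr_ge0// => i _; rewrite mxE.
by rewrite sumr_ge0// => j _; rewrite mxE -expr2 sqr_ge0.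
Qed.

Lemma sigma2_polar n (D N : 'M[R]_n) :
  sigma2 (D + N) = sigma2 D + sigma2 N + (\tr D * \tr N - \tr (D *m N)).
Proof.
rewrite /sigma2 mulmxDl !mulmxDr !mxtraceD [\tr (N *m D)]mxtrace_mulC.
by field.
Qed.

(** The reversed Cauchy-Schwarz inequality in the forward cone.  With |.| the
    Frobenius norm, tr D >= |D| and tr N >= |N|, so that
    tr D tr N >= |D| |N| >= tr (D N).  Expanding the squared norm of
    (tr N) D - (tr D) N avoids taking square roots. *)
Lemma sigma2_polar_ge0 n (D N : 'M[R]_n) : D^T = D -> N^T = N ->
  0 < \tr D -> 0 <= sigma2 D -> 0 <= \tr N -> 0 <= sigma2 N ->
  0 <= \tr D * \tr N - \tr (D *m N).
Proof.
move=> Ds Ns; set d := \tr D; set p := \tr N => d0; rewrite /sigma2 -/d -/p.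
move=> sD p0 sN.
have : 0 <= \tr ((p *: D - d *: N) *m (p *: D - d *: N)).
  by apply: mxtrace_sqr_ge0; rewrite linearB/= !linearZ/= Ds Ns.
rewrite mulmxBl !mulmxBr -!scalemxAl -!scalemxAr !linearB/= !mxtraceZ.
rewrite [\tr (N *m D)]mxtrace_mulC.
set x := \tr (D *m D) in sD *; set y := \tr (N *m N) in sN *.
set z := \tr (D *m N) => h.
have [pe|pn] := eqVneq p 0.
  rewrite pe mulr0 sub0r; rewrite pe expr0n/= in sN.
  have y0 : y <= 0 by lra.
  have yge : 0 <= y by exact: mxtrace_sqr_ge0.
  have ye : y = 0 by lra.
  have N0 : N = 0.
    move: ye; rewrite /y -{2}Ns /mxtrace => /eqP.
    rewrite psumr_eq0; last first.
      by move=> i _; rewrite mxE sumr_ge0// => j _; rewrite mxE -expr2 sqr_ge0.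
    move=> /allP N0; apply/matrixP => i j; rewrite [RHS]mxE.
    have := N0 i; rewrite mem_index_enum => /(_ isT)/=.
    rewrite mxE psumr_eq0; last by move=> k _; rewrite mxE -expr2 sqr_ge0.
    move=> /allP/(_ j); rewrite mem_index_enum => /(_ isT)/=.
    by rewrite mxE -expr2 sqrf_eq0 => /eqP.
  by rewrite /z N0 mulmx0 mxtrace0 oppr0.
have pp : 0 < p by rewrite lt_neqAle eq_sym pn.
rewrite -(pmulr_rge0 _ (mulr_gt0 d0 pp)).
have e1 : 0 <= p ^+ 2 * (d ^+ 2 - x) by rewrite mulr_ge0 ?sqr_ge0//; lra.
have e2 : 0 <= d ^+ 2 * (p ^+ 2 - y) by rewrite mulr_ge0 ?sqr_ge0//; lra.
have -> : d * p * (d * p - z) =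
  (p * (p * x) - d * (p * z) - (p * (d * z) - d * (d * y))
   + p ^+ 2 * (d ^+ 2 - x) + d ^+ 2 * (p ^+ 2 - y)) / 2 by field.
rewrite divr_ge0//; lra.
Qed.

(** Ellipticity of the equation: sigma2 grows when an admissible matrix is
    increased. *)
Lemma sigma2_mono n (D N : 'M[R]_n) : D^T = D -> N^T = N ->
  0 < \tr D -> 0 <= sigma2 D -> 0 <= \tr N -> 0 <= sigma2 N ->
  sigma2 D + sigma2 N <= sigma2 (D + N).
Proof.
by move=> *; rewrite sigma2_polar lerDl; exact: sigma2_polar_ge0.
Qed.

Lemma sigma2Z n c (M : 'M[R]_n) : sigma2 (c *: M) = c ^+ 2 * sigma2 M.
Proof.
rewrite /sigma2 -scalemxAl -scalemxAr !mxtraceZ; by field.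
Qed.

Lemma sigma2_conj n (M Q : 'M[R]_n) : Q *m Q^T = 1%:M ->
  sigma2 (Q^T *m M *m Q) = sigma2 M.
Proof.
move=> QQ; rewrite /sigma2.
have tr_conj (N : 'M[R]_n) : \tr (Q^T *m N *m Q) = \tr N.
  by rewrite mxtrace_mulC mulmxA QQ mul1mx.
have -> : Q^T *m M *m Q *m (Q^T *m M *m Q) = Q^T *m (M *m M) *m Q.
  by rewrite !mulmxA -(mulmxA _ Q) QQ mulmx1.
by rewrite !tr_conj.
Qed.

End Sigma2.

Section Dim3.
Variable R : realFieldType.
Implicit Types (A C M : 'M[R]_3).

Definition vec3 (a b c : R) : 'rV[R]_3 := \row_j [:: a; b; c]`_j.

Definition sym3 (x c d k l m : R) : 'M[R]_3 :=
  \matrix_(i, j) (nth [::] [:: [:: x; c; d]; [:: c; k; m]; [:: d; m; l]] i)`_j.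

Let o0 : 'I_3 := ord0.
Let o1 : 'I_3 := lift ord0 ord0.
Let o2 : 'I_3 := lift ord0 (lift ord0 ord0).

Lemma sym3E A : A^T = A ->
  A = sym3 (A o0 o0) (A o0 o1) (A o0 o2) (A o1 o1) (A o2 o2) (A o1 o2).
Proof.
move=> As; have Aij i j : A i j = A j i by rewrite -{1}As mxE.
apply/matrixP => i j; rewrite mxE.
case: i => [[|[|[|//]]] hi]; case: j => [[|[|[|//]]] hj] /=;
  rewrite ?[A o0 o0]/=; try (by congr (A _ _); apply: val_inj);
  by rewrite Aij; congr (A _ _); apply: val_inj.
Qed.

Lemma sum3 (f : 'I_3 -> R) : \sum_i f i = f o0 + f o1 + f o2.
Proof. by rewrite !big_ord_recl big_ord0 addr0 !addrA. Qed.

Lemma qform_sym3 x c d k l m p q r :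
  qform (sym3 x c d k l m) (vec3 p q r) =
  x * p ^+ 2 + k * q ^+ 2 + l * r ^+ 2
  + 2 * (c * p * q + d * p * r + m * q * r).
Proof. by rewrite /qform mxE sum3 !mxE !sum3 !mxE /=; ring. Qed.

Lemma trace_sym3 x c d k l m : \tr (sym3 x c d k l m) = x + k + l.
Proof. by rewrite /mxtrace sum3 !mxE. Qed.

Lemma sigma2_sym3 x c d k l m : sigma2 (sym3 x c d k l m) =
  x * k + x * l + k * l - c ^+ 2 - d ^+ 2 - m ^+ 2.
Proof.
by rewrite /sigma2 trace_sym3 /mxtrace sum3 !mxE !sum3 !mxE /=; field.
Qed.

Lemma psd_sym3 x c d k l m : psd (sym3 x c d k l m) ->
  [/\ 0 <= x, 0 <= k, 0 <= l, c ^+ 2 <= x * k & (d ^+ 2 <= x * l /\ m ^+ 2 <= k * l)].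
Proof.
have aux (s t e : R) : (forall p q, 0 <= s * p ^+ 2 + t * q ^+ 2 + 2 * e * p * q) ->
   [/\ 0 <= s, 0 <= t & e ^+ 2 <= s * t].
  move=> h; have hs : 0 <= s by have := h 1 0; rewrite !expr0n expr1n/=; lra.
  have ht : 0 <= t by have := h 0 1; rewrite !expr0n expr1n/=; lra.
  split => //; have [t0|t0] := eqVneq t 0.
    have := h (- e) (s + 1); rewrite t0.
    have -> : s * (- e) ^+ 2 + 0 * (s + 1) ^+ 2 + 2 * e * - e * (s + 1) =
      - ((s + 2) * e ^+ 2) by ring.
    by rewrite oppr_ge0 mulr0 pmulr_rle0//; lra.
  have tp : 0 < t by rewrite lt_neqAle eq_sym t0.
  rewrite -subr_ge0 -(pmulr_rge0 _ tp).
  have -> : t * (s * t - e ^+ 2) = s * t ^+ 2 + t * (- e) ^+ 2 + 2 * e * t * - e by ring.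
  exact: h.
move=> [_ h].
have [] := aux x k c.
  move=> p q; have := h (vec3 p q 0); rewrite qform_sym3.
  by rewrite expr0n !(mulr0, addr0) /=; lra.
have [] := aux x l d.
  move=> p q; have := h (vec3 p 0 q); rewrite qform_sym3.
  by rewrite expr0n !(mulr0, addr0, mul0r, add0r) /=; lra.
have [] := aux k l m.
  move=> p q; have := h (vec3 0 p q); rewrite qform_sym3.
  by rewrite expr0n !(mulr0, addr0, mul0r, add0r) /=; lra.
by [].
Qed.

Lemma psd_trace_sigma2 A : psd A -> 0 <= \tr A /\ 0 <= sigma2 A.
Proof.
move=> Ap; have [As _] := Ap; move: Ap; rewrite (sym3E As) => /psd_sym3.
by rewrite trace_sym3 sigma2_sym3 => -[? ? ? ? [? ?]]; split; lra.
Qed.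

Lemma vec3_neq0 p q r : p != 0 \/ q != 0 \/ r != 0 -> vec3 p q r != 0.
Proof.
move=> h; apply/eqP => v0.
have e i : vec3 p q r 0 i = 0 by rewrite v0 mxE.
have /= := e o0; have /= := e o1; have /= := e o2; rewrite !mxE /= => r0 q0 p0.
by move: h; rewrite r0 q0 p0 eqxx => -[|[|]].
Qed.

Definition det_sym3 (x c d k l m : R) :=
  x * (k * l - m ^+ 2) - (l * c ^+ 2 - 2 * m * c * d + k * d ^+ 2).

(** Sylvester's criterion, in the direction from the form to the minors.  The
    last two test vectors are rows of cofactors. *)
Lemma posdef_sym3 x c d k l m : posdef (sym3 x c d k l m) ->
  [/\ 0 < x, 0 < k, 0 < k * l - m ^+ 2 & 0 < det_sym3 x c d k l m].
Proof.
move=> [_ h].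
have x0 : 0 < x.
  have := h _ (@vec3_neq0 1 0 0 (or_introl (oner_neq0 R))).
  by rewrite qform_sym3; lra.
have k0 : 0 < k.
  have := h _ (@vec3_neq0 0 1 0 (or_intror (or_introl (oner_neq0 R)))).
  by rewrite qform_sym3; lra.
have D0 : 0 < k * l - m ^+ 2.
  have kn0 : k != 0 by rewrite gt_eqF.
  have := h _ (@vec3_neq0 0 m (- k) ltac:(by right; right; rewrite oppr_eq0)).
  by rewrite qform_sym3 -[0 < k * l - _](pmulr_rgt0 _ k0); congr (_ < _); ring.
have D0n : k * l - m ^+ 2 != 0 by rewrite gt_eqF.
split => //.
have := h _ (@vec3_neq0 (k * l - m ^+ 2) (d * m - c * l) (c * m - d * k) (or_introl D0n)).
by rewrite qform_sym3 -[0 < det_sym3 _ _ _ _ _ _](pmulr_rgt0 _ D0) /det_sym3; congr (_ < _); ring.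
Qed.

Lemma posdef_sigma2 A : posdef A -> 0 < sigma2 A.
Proof.
move=> Ap; have [As _] := Ap; have := posdefW Ap; move: Ap.
rewrite (sym3E As).
move=> /posdef_sym3[_ _ ? _] /psd_sym3[_ _ _ ? [? _]]; rewrite sigma2_sym3; lra.
Qed.

Definition adj_sym3 (x c d k l m : R) :=
  sym3 (k * l - m ^+ 2) (d * m - c * l) (c * m - d * k)
    (x * l - d ^+ 2) (x * k - c ^+ 2) (c * d - x * m).

Lemma inv_sym3 x c d k l m : det_sym3 x c d k l m != 0 ->
  invmx (sym3 x c d k l m) = (det_sym3 x c d k l m)^-1 *: adj_sym3 x c d k l m.
Proof.
move=> D0; set S := sym3 _ _ _ _ _ _; set T := _ *: _.
have ST : S *m T = 1%:M.
  apply/matrixP => i j; rewrite !mxE sum3 !mxE.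
  case: i => [[|[|[|//]]] hi]; case: j => [[|[|[|//]]] hj] /=;
    rewrite /det_sym3; field; exact: D0.
have [Su _] := mulmx1_unit ST.
by rewrite -[LHS]mulmx1 -ST mulmxA mulVmx// mul1mx.
Qed.

Definition E00 : 'M[R]_3 := delta_mx 0 0.

Lemma E00E : E00 = sym3 1 0 0 0 0 0.
Proof.
apply/matrixP => i j; rewrite !mxE.
by case: i => [[|[|[|//]]] hi]; case: j => [[|[|[|//]]] hj].
Qed.

Lemma scale_sym3 a x c d k l m :
  a *: sym3 x c d k l m = sym3 (a * x) (a * c) (a * d) (a * k) (a * l) (a * m).
Proof.
apply/matrixP => i j; rewrite !mxE.
by case: i => [[|[|[|//]]] hi]; case: j => [[|[|[|//]]] hj].
Qed.

Lemma add_sym3 x c d k l m x' c' d' k' l' m' :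
  sym3 x c d k l m + sym3 x' c' d' k' l' m' =
  sym3 (x + x') (c + c') (d + d') (k + k') (l + l') (m + m').
Proof.
apply/matrixP => i j; rewrite !mxE.
by case: i => [[|[|[|//]]] hi]; case: j => [[|[|[|//]]] hj].
Qed.

(** The variable is C = A^-1 rather than A because parallel sums of the A become
    sums of the C. *)
Definition dual_cone (tau a : R) C :=
  0 < a /\ posdef C /\
  cone_ineq tau a (C o0 o0) (C o0 o1) (C o0 o2) (C o1 o1) (C o2 o2) (C o1 o2).

Lemma dual_coneP tau a C : 0 < a -> posdef C ->
  dual_cone tau a C <-> sigma2 (a *: invmx C - tau *: E00) <= 4^-1.
Proof.
move=> a0 Cp; have [Cs _] := Cp; rewrite /dual_cone.
move: Cp; rewrite (sym3E Cs).
move: (C o0 o0) (C o0 o1) (C o0 o2) (C o1 o1) (C o2 o2) (C o1 o2) => x c d k l m Cp.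
have [x0 k0 d0 D0] := posdef_sym3 Cp; rewrite !mxE /=.
rewrite inv_sym3 ?gt_eqF// /adj_sym3 E00E -[- (tau *: _)]scaleNr !scale_sym3 add_sym3 sigma2_sym3.
rewrite !mulr0 !addr0 mulr1.
set S := (X in _ <-> X <= _).
have SE : S - 4^-1 =
  (a ^+ 2 * (k + l) + a * tau * (c ^+ 2 + d ^+ 2)
    + (l * c ^+ 2 - 2 * m * c * d + k * d ^+ 2) / 4 -
  x * (a * tau * (k + l) + (k * l - m ^+ 2) / 4 - a ^+ 2)) / det_sym3 x c d k l m.
  by rewrite /S /det_sym3; field; rewrite gt_eqF.
rewrite -[S <= _]subr_le0 SE pmulr_lle0 ?invr_gt0// subr_le0 /cone_ineq.
by split => [[_ []]//|].
Qed.

Lemma dual_coneD tau a C a' C' : 0 <= tau ->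
  dual_cone tau a C -> dual_cone tau a' C' -> dual_cone tau (a + a') (C + C').
Proof.
move=> tau0 [a0 [Cp h]] [a0' [Cp' h']].
have Cp'' := posdefD Cp Cp'.
split; first exact: addr_gt0.
split => //; rewrite !mxE.
have [Cs _] := Cp; have [Cs' _] := Cp'.
have [Cs'' _] := Cp''.
move: Cp; rewrite {1}(sym3E Cs) => /posdef_sym3[x0 k0 d0 _].
move: Cp'; rewrite {1}(sym3E Cs') => /posdef_sym3[x0' k0' d0' _].
move: Cp''; rewrite {1}(sym3E Cs'') !mxE => /posdef_sym3[_ _ d0'' _].
exact: cone_ineq_add.
Qed.

Lemma dual_coneZ tau a C c : 0 < c -> dual_cone tau a C ->
  dual_cone tau (c * a) (c *: C).
Proof.
move=> c0 [a0 [Cp h]]; split; first exact: mulr_gt0.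
split; first exact: posdefZ.
rewrite !mxE; move: h; rewrite /cone_ineq -subr_ge0 => h; rewrite -subr_ge0.
move: (C o0 o0) (C o0 o1) (C o0 o2) (C o1 o1) (C o2 o2) (C o1 o2) h => x y z k l m h.
have := mulr_ge0 (ltW (exprn_gt0 3 c0)) h; congr (_ <= _); by field.
Qed.

Lemma dual_cone_sum tau (I : finType) (P : pred I) (mu a : I -> R)
    (C : I -> 'M[R]_3) : 0 <= tau ->
  (forall i, P i -> 0 < mu i) -> (forall i, P i -> dual_cone tau (a i) (C i)) ->
  0 < \sum_(i | P i) mu i * a i ->
  dual_cone tau (\sum_(i | P i) mu i * a i) (\sum_(i | P i) mu i *: C i).
Proof.
move=> tau0 mu0 h.
pose K (aC : R * 'M[R]_3) := aC = (0, 0) \/ dual_cone tau aC.1 aC.2.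
have : K (\sum_(i | P i) mu i * a i, \sum_(i | P i) mu i *: C i).
  apply: (big_ind2 (fun x y => K (x, y))); first by left.
    move=> x1 x2 y1 y2 [[-> ->]|/= h1] [[-> ->]|/= h2].
    - by left; rewrite !addr0.
    - by right; rewrite !add0r.
    - by right; rewrite !addr0.
    - by right; exact: dual_coneD.
  by move=> i Pi; right; apply: dual_coneZ; [exact: mu0|exact: h].
by case=> [[-> _]|//]; rewrite ltxx.
Qed.

(** Lowering a to r a makes the inequality strict, which leaves room for turning
    the semidefinite A into the invertible A + e. *)
Lemma sigma2_shrink tau a A r : 0 <= tau -> 0 < a -> psd A -> 0 < r < 1 ->
  sigma2 (a *: A - tau *: E00) = 4^-1 ->
  exists2 e, 0 < e & sigma2 ((r * a) *: (A + e%:M) - tau *: E00) <= 4^-1.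
Proof.
move=> tau0 a0 Ap /andP[r0 r1].
have [As _] := Ap; have [] := psd_trace_sigma2 Ap.
have eE (e : R) : e%:M = sym3 e 0 0 e e 0.
  apply/matrixP => i j; rewrite !mxE.
  by case: i => [[|[|[|//]]] hi]; case: j => [[|[|[|//]]] hj].
rewrite (sym3E As).
move: (A o0 o0) (A o0 o1) (A o0 o2) (A o1 o1) (A o2 o2) (A o1 o2) => x c d k l m.
rewrite trace_sym3 E00E -[- (tau *: _)]scaleNr !scale_sym3 add_sym3 !sigma2_sym3 => T0 S0 h.
pose K := a ^+ 2 * (2 * (x + k + l) + 3).
have K0 : 0 < K by rewrite mulr_gt0 ?exprn_gt0//; lra.
pose e := Num.min 1 ((1 - r) / 4 / K).
have e0 : 0 < e.
  by rewrite lt_min ltr01/= !divr_gt0// subr_gt0.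
have e1 : e <= 1 by rewrite ge_min lexx.
have eK : e * K <= (1 - r) / 4.
  by rewrite -ler_pdivlMr// ge_min lexx orbT.
exists e => //.
rewrite (eE e) !(add_sym3, scale_sym3) sigma2_sym3.
rewrite !(mulr0, addr0, mulr1) in h *.
set S := x * k + x * l + k * l - c ^+ 2 - d ^+ 2 - m ^+ 2 in S0.
have hS : a ^+ 2 * S - a * tau * (k + l) = 4^-1 by rewrite -h /S; ring.
have -> : (r * a * (x + e) + - tau) * (r * a * (k + e)) +
  (r * a * (x + e) + - tau) * (r * a * (l + e)) +
  r * a * (k + e) * (r * a * (l + e)) - (r * a * c) ^+ 2 -
  (r * a * d) ^+ 2 - (r * a * m) ^+ 2 =
  r * (a ^+ 2 * S - a * tau * (k + l)) - r * (1 - r) * (a ^+ 2 * S)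
  + r ^+ 2 * (e * K) - 3 * (r * a) ^+ 2 * (e - e ^+ 2) - 2 * r * e * (a * tau).
  by rewrite /S /K; ring.
rewrite hS.
have t1 : 0 <= r * (1 - r) * (a ^+ 2 * S).
  by rewrite mulr_ge0 ?(mulr_ge0 (sqr_ge0 a) S0)// mulr_ge0 ?subr_ge0 //; exact: ltW.
have t2 : 0 <= 3 * (r * a) ^+ 2 * (e - e ^+ 2).
  have h1 : 0 <= e - e ^+ 2 by rewrite subr_ge0 expr2 ler_piMl// ltW.
  by rewrite mulr_ge0// mulr_ge0// sqr_ge0.
have t3 : 0 <= 2 * r * e * (a * tau).
  by rewrite !mulr_ge0 //; exact: ltW.
have eK0 : 0 <= e * K by rewrite mulr_ge0// ltW.
have t4 : r ^+ 2 * (e * K) <= e * K.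
  by rewrite ler_piMl// exprn_ile1// ltW.
by lra.
Qed.

Lemma sigma2_parallel_sum_E00 (I : finType) (P : pred I) (mu a : I -> R)
    (A : I -> 'M[R]_3) (tau at_ : R) (At : 'M[R]_3) :
  0 <= tau ->
  (forall i, P i -> 0 < mu i) -> (forall i, P i -> 0 < a i) ->
  (forall i, P i -> psd (A i)) ->
  (forall i, P i -> sigma2 (a i *: A i - tau *: E00) = 4^-1) ->
  At^T = At -> 0 < at_ ->
  sigma2 (at_ *: At - tau *: E00) = 4^-1 -> 0 < \tr (at_ *: At - tau *: E00) ->
  (forall f : I -> 'rV[R]_3,
    qform At (\sum_(i | P i) mu i *: f i)
      <= \sum_(i | P i) mu i * qform (A i) (f i)) ->
  \sum_(i | P i) mu i * a i <= at_.
Proof.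
move=> tau0 mu0 a0 Ap hA Ats at0 hs ht hq; rewrite leNgt; apply/negP => lta.
set s := \sum_(i | P i) mu i * a i in lta.
have s0 : 0 < s by exact: lt_trans lta.
(* any r < 1 with at_ < r s would do *)
pose r := (1 + at_ / s) / 2.
have ats : at_ / s < 1 by rewrite ltr_pdivrMr// mul1r.
have ats0 : 0 < at_ / s by exact: divr_gt0.
have r01 : 0 < r < 1 by rewrite /r; apply/andP; split; lra.
have ltr : at_ < r * s by rewrite -ltr_pdivrMr// /r; lra.
have hex : forall i, exists e, P i -> 0 < e /\
    sigma2 ((r * a i) *: (A i + e%:M) - tau *: E00) <= 4^-1.
  move=> i; case: (boolP (P i)) => [Pi|_]; last by exists 0.
  have [e e0 he] := sigma2_shrink tau0 (a0 i Pi) (Ap i Pi) r01 (hA i Pi).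
  by exists e.
have [e he] := boolp.choice hex.
pose Ae i := A i + (e i)%:M.
have Aep i : P i -> posdef (Ae i).
  by move=> Pi; apply: posdef_shift; [exact: Ap|have [] := he i Pi].
have r0 : 0 < r by case/andP: r01.
have sE : \sum_(i | P i) mu i * (r * a i) = r * s.
  by rewrite /s mulr_sumr; apply: eq_bigr => i _; rewrite mulrCA.
have := @dual_cone_sum tau I P mu (fun i => r * a i) (fun i => invmx (Ae i)) tau0 mu0.
rewrite sE => /(_ _ (mulr_gt0 r0 s0)) [].
  move=> i Pi; apply/dual_coneP.
  - by rewrite mulr_gt0// a0.
  - exact/posdef_inv/Aep.
  - by rewrite invmxK; have [] := he i Pi.
set C := \sum_(i | P i) _ => rs0 [Cp hC].
have {hC} := (iffLR (@dual_coneP tau (r * s) C rs0 Cp)) (conj rs0 (conj Cp hC)).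
have Cu := posdef_unit Cp; have [Cs _] := Cp.
have Bp := posdef_inv Cp.
have hle : forall v, qform At v <= qform (invmx C) v.
  apply: (@qform_le_inv_sum _ _ I P mu Ae At C) => // f.
  apply: le_trans (hq f) _; apply: ler_sum => i Pi.
  rewrite ler_wpM2l ?(ltW (mu0 i Pi))// qformD lerDl -scalemx1 qformZ.
  by rewrite mulr_ge0 ?qform1_ge0// ltW//; have [] := he i Pi.
move: Bp hle; set B := invmx C => Bp hle; have [Bs _] := Bp.
have Np : psd (at_ *: (B - At)).
  split; first by rewrite linearZ/= linearB/= Bs Ats.
  by move=> v; rewrite qformZ mulr_ge0 ?(ltW at0)// qformB subr_ge0.
have N2p : posdef ((r * s - at_) *: B) by apply: posdefZ => //; rewrite subr_gt0.
have Es : E00^T = E00 by rewrite /E00 trmx_delta.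
have Ds : (at_ *: At - tau *: E00)^T = at_ *: At - tau *: E00.
  by rewrite linearB/= !linearZ/= Ats Es.
have -> : (r * s) *: B - tau *: E00 =
   (at_ *: At - tau *: E00) + (at_ *: (B - At) + (r * s - at_) *: B).
  by apply/matrixP => i j; rewrite !mxE; ring.
have Mp : posdef (at_ *: (B - At) + (r * s - at_) *: B).
  split; first by rewrite linearD/= (proj1 Np) (proj1 N2p).
  by move=> v v0; rewrite qformD ltr_wpDl ?(proj2 Np)// (proj2 N2p).
have [Mt _] := psd_trace_sigma2 (posdefW Mp).
have Ms := posdef_sigma2 Mp.
have s4 : 0 < 4^-1 :> R by rewrite invr_gt0.
rewrite leNgt => /negP; apply.
apply: lt_le_trans (sigma2_mono Ds (proj1 Mp) ht _ Mt (ltW Ms)); rewrite hs.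
  by rewrite ltrDl.
exact: ltW.
Qed.

End Dim3.

Section Rotation.
Variable R : rcfType.

(** The reflection exchanging v and |v| e_0 is the identity minus 2 w^T w / |w|^2
    with w = v - |v| e_0, unless w = 0. *)
Lemma rotate_to_axis n (v : 'rV[R]_n.+1) : exists (Q : 'M[R]_n.+1) (r : R),
  Q *m Q^T = 1%:M /\ v *m Q = r *: delta_mx 0 0.
Proof.
pose r := Num.sqrt ((v *m v^T) 0 0); pose e : 'rV[R]_n.+1 := delta_mx 0 0.
have vv0 : 0 <= (v *m v^T) 0 0 by have := qform1_ge0 v; rewrite /qform mulmx1.
have r2 : r ^+ 2 = (v *m v^T) 0 0 by rewrite sqr_sqrtr.
have scal (A : 'M[R]_1) : A = (A 0 0)%:M by rewrite [LHS]mx11_scalar.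
have ee : e *m e^T = 1%:M.
  by rewrite /e trmx_delta mul_delta_mx; apply/matrixP => i j; rewrite !mxE !ord1.
have [w wE] : exists w, w = v - r *: e by exists (v - r *: e).
have [w0|wn0] := eqVneq w 0.
  exists 1%:M, r; rewrite trmx1 !mulmx1; split => //.
  by apply/eqP; rewrite -subr_eq0 -/e -wE w0.
have := qform1_gt0 wn0; rewrite /qform mulmx1; set s := (w *m w^T) 0 0 => s0.
have wwE : w *m w^T = s%:M by rewrite [LHS]scal.
pose Q : 'M[R]_n.+1 := 1%:M - (2 / s) *: (w^T *m w).
have Qs : Q^T = Q.
  by rewrite /Q linearB/= linearZ/= trmx_mul trmxK trmx1.
exists Q, r; split.
  rewrite Qs /Q mulmxBl mul1mx mulmxBr mulmx1 -scalemxAl -scalemxAr scalerA.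
  have -> : w^T *m w *m (w^T *m w) = s *: (w^T *m w).
    by rewrite -mulmxA (mulmxA w) wwE mul_scalar_mx -scalemxAr.
  rewrite scalerA; have -> : 2 / s * (2 / s) * s = 2 / s + 2 / s.
    by field; rewrite gt_eqF.
  by rewrite scalerDl opprB addrK subrK.
have wT : w^T = v^T - r *: e^T by rewrite wE linearB/= linearZ.
have vw : v *m w^T = (s / 2)%:M.
  have [a ha] : exists a, v *m e^T = a%:M by eexists; exact: scal.
  have ev : e *m v^T = a%:M.
    by apply: trmx_inj; rewrite trmx_mul trmxK ha tr_scalar_mx.
  have vv : v *m v^T = (r ^+ 2)%:M by rewrite r2 -scal.
  have wv : v *m w^T = (r ^+ 2 - r * a)%:M.
    by rewrite wT mulmxBr -scalemxAr vv ha scale_scalar_mx raddfB.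
  have : s%:M = ((r ^+ 2 - r * a) *+ 2)%:M :> 'M[R]_1.
    rewrite -wwE {1}wE mulmxBl wv -scalemxAl wT mulmxBr.
    rewrite -scalemxAr ev ee scalerBr !scale_scalar_mx -!raddfB/=; congr (_%:M).
    by rewrite mulr1; ring.
  move=> /matrixP/(_ 0 0); rewrite !mxE eqxx !mulr1n => ->.
  by rewrite wv; congr (_%:M); field.
rewrite /Q mulmxBr mulmx1 -scalemxAr mulmxA vw mul_scalar_mx scalerA.
have -> : 2 / s * (s / 2) = 1 by field; rewrite gt_eqF.
by rewrite scale1r wE subKr.
Qed.

(** This is what a positive maximum contradicts.  A rotation takes th to the first
    axis and reduces it to [sigma2_parallel_sum_E00].  There At is at most the
    parallel sum B of the A i; were sum mu a larger than at_, [sigma2_mono] would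
    give sigma2 > 1/4 for the pair (sum mu a, B), against [dual_cone_sum]. *)
Lemma sigma2_parallel_sum (I : finType) (P : pred I) (mu a : I -> R)
    (A : I -> 'M[R]_3) (th : 'rV[R]_3) (at_ : R) (At : 'M[R]_3) :
  (forall i, P i -> 0 < mu i) -> (forall i, P i -> 0 < a i) ->
  (forall i, P i -> psd (A i)) ->
  (forall i, P i -> sigma2 (a i *: A i - th^T *m th) = 4^-1) ->
  At^T = At -> 0 < at_ ->
  sigma2 (at_ *: At - th^T *m th) = 4^-1 -> 0 < \tr (at_ *: At - th^T *m th) ->
  (forall f : I -> 'rV[R]_3,
    qform At (\sum_(i | P i) mu i *: f i)
      <= \sum_(i | P i) mu i * qform (A i) (f i)) ->
  \sum_(i | P i) mu i * a i <= at_.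
Proof.
move=> mu0 a0 Ap hA Ats at0 hs ht hq.
have [Q [r [QQ thQ]]] := rotate_to_axis th.
have Qu : Q^T *m Q = 1%:M by apply: mulmx1C.
have rot b (M : 'M[R]_3) : b *: (Q^T *m M *m Q) - r ^+ 2 *: E00 R =
    Q^T *m (b *: M - th^T *m th) *m Q.
  rewrite mulmxBr mulmxBl -scalemxAr -scalemxAl; congr (_ - _).
  rewrite -!mulmxA thQ mulmxA -trmx_mul thQ -scalemxAr [(_ *: _)^T]linearZ/= -scalemxAl.
  by rewrite trmx_delta mul_delta_mx scalerA.
apply: (@sigma2_parallel_sum_E00 R I P mu a (fun i => Q^T *m A i *m Q) (r ^+ 2) at_
  (Q^T *m At *m Q)) => //.
- exact: sqr_ge0.
- by move=> i Pi; apply/psd_conj/Ap.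
- by move=> i Pi; rewrite rot sigma2_conj// hA.
- by rewrite !trmx_mul trmxK Ats mulmxA.
- by rewrite rot sigma2_conj.
- by rewrite rot mxtrace_mulC mulmxA QQ mul1mx.
move=> f; rewrite qform_conj.
have := hq (fun i => f i *m Q^T); congr (qform _ _ <= _).
  by rewrite mulmx_suml; apply: eq_bigr => i _; rewrite scalemxAl.
by apply: eq_bigr => i _; rewrite qform_conj.
Qed.

End Rotation.

(** * Second-order calculus of functions of class C^2 *)

Section Calculus.
Variable R : realType.

Lemma entry_le_norm n (h : 'rV[R]_n) i : `|h 0 i| <= `|h|.
Proof.
by rewrite [leRHS]/Num.norm /= mx_normrE; apply/bigmax_geP; right; exists (0, i).
Qed.

Lemma norm_le_entries n (h : 'rV[R]_n) e :
  0 <= e -> (forall i, `|h 0 i| <= e) -> `|h| <= e.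
Proof.
move=> e0 he; rewrite [leLHS]/Num.norm /= mx_normrE; apply/bigmax_leP; split => //.
by move=> [i j] _ /=; rewrite ord1.
Qed.

Lemma nbhs_eps (V : normedModType R) (x : V) (P : set V) :
  nbhs x P -> exists2 d : R, 0 < d & forall h, `|h| < d -> P (x + h).
Proof.
move=> /nbhs_ballP[d d0 hd]; exists d => // h hh; apply: hd.
by rewrite -ball_normE /ball_/= opprD addrA subrr sub0r normrN.
Qed.

Lemma continuous_eps (V : normedModType R) (f : V -> R) x e :
  {for x, continuous f} -> 0 < e ->
  exists2 d : R, 0 < d & forall h, `|h| < d -> `|f (x + h) - f x| <= e.
Proof.
move=> cf e0; apply: (@nbhs_eps _ x (fun y => `|f y - f x| <= e)).
by move/cvgrPdist_le : cf => /(_ _ e0); apply: filterS => y; rewrite distrC.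
Qed.

Lemma is_derive_eps (g : R -> R) s d :
  (forall e, 0 < e -> exists2 r : R, 0 < r &
    forall h, `|h| < r -> `|g (s + h) - g s - d * h| <= e * `|h|) ->
  is_derive s 1 g d.
Proof.
move=> H; have C : (h^-1 *: ((g \o shift s) (h *: 1) - g s)) @[h --> 0^'] --> d.
  apply/cvgrPdist_le => e e0; have [r r0 hr] := H e e0.
  near=> h; have h0 : h != 0 by near: h; exact: nbhs_dnbhs_neq.
  have hlt : `|h| < r by near: h; apply: dnbhs0_lt.
  have := hr h hlt.
  rewrite -ler_pdivrMr ?normr_gt0// -normfV -normrM -normrN.
  congr (`| _ | <= _); rewrite /GRing.scale/= mulr1 [h + s]addrC; field; exact: h0.
by split; [apply/cvg_ex; exists d|exact: cvg_lim].
Unshelve. all: by end_near. Qed.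

Lemma derivable_line (V : normedModType R) (f : V -> R) x v (s : R) :
  derivable f (x + s *: v) v ->
  is_derive s 1 (fun r => f (x + r *: v)) ('D_v f (x + s *: v)).
Proof.
have E : (fun h : R => h^-1 *: (((fun r : R => f (x + r *: v)) \o shift s) (h *: 1)
     - f (x + s *: v))) =
  (fun h => h^-1 *: ((f \o shift (x + s *: v)) (h *: v) - f (x + s *: v))).
  apply/funext => h /=; congr (_ *: (f _ - _)).
  by rewrite [h *: 1]mulr1 scalerDl addrCA addrA [_ + x]addrC -!addrA [h *: v + _]addrC.
move=> df; split; first by rewrite /derivable E.
by rewrite /derive E.
Qed.

Lemma mvt01 (G G' : R -> R) :
  (forall s : R, 0 <= s <= 1 -> is_derive s 1 G (G' s)) ->
  exists2 c, 0 <= c <= 1 & G 1 - G 0 = G' c.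
Proof.
move=> H; have [||c] := @MVT_segment R G G' 0 1 ler01.
- by move=> x; rewrite in_itv/= => /andP[x0 x1]; apply: H; rewrite !ltW.
- apply: derivable_within_continuous => x; rewrite in_itv/= => hx.
  by have [] := H x hx.
by rewrite in_itv/= => hc e; exists c => //; rewrite e subr0 mulr1.
Qed.

Lemma is_derive_scale (g : R -> R) (k s d : R) : is_derive (s * k) 1 g d ->
  is_derive s 1 (fun r => g (r * k)) (d * k).
Proof.
move=> dg; have dk : is_derive s 1 (fun r : R => r * k) k.
  by apply: is_derive_eq; rewrite /GRing.scale/= mulr0 add0r mulr1.
exact: (@is_derive1_comp R g (fun r => r * k) s d k dg dk).
Qed.

Lemma class_C_continuous n k (A : set 'rV[R]_n.+1) (f : 'rV[R]_n.+1 -> R) x :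
  class_C k A f -> A x ->
  {for x, continuous f}.
Proof. by case: k => [|k] [h _]; exact: h. Qed.

Lemma class_C_S n k (A : set 'rV[R]_n.+1) (f : 'rV[R]_n.+1 -> R) i : class_C k.+1 A f ->
  class_C k A (partial i f).
Proof. by move=> [_ /(_ i)[]]. Qed.

Lemma class_C_derivable n k (A : set 'rV[R]_n.+1) (f : 'rV[R]_n.+1 -> R) i x :
  class_C k.+1 A f -> A x ->
  derivable f x (delta_mx 0 i).
Proof. by move=> [_ /(_ i)[h _]]; exact: h. Qed.

Lemma class_CW n k (A : set 'rV[R]_n.+1) (f : 'rV[R]_n.+1 -> R) : class_C k.+1 A f -> class_C k A f.
Proof.
elim: k f => [|k IH] f; first by case=> h _.
by move=> [h1 h2]; split => // i; have [h3 /IH h4] := h2 i.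
Qed.

Lemma open_eps n (A : set 'rV[R]_n) x : open A -> A x ->
  exists2 d : R, 0 < d & forall h, `|h| < d -> A (x + h).
Proof. by move=> oA Ax; apply: nbhs_eps; exact: open_nbhs_nbhs. Qed.

Lemma open_line_eps n (A : set 'rV[R]_n) x v : open A -> A x ->
  exists2 d : R, 0 < d & forall s : R, `|s| < d -> A (x + s *: v).
Proof.
move=> oA Ax; have [d d0 hd] := open_eps oA Ax.
have v0 : 0 < `|v| + 1 by rewrite ltr_wpDl.
exists (d / (`|v| + 1)); first exact: divr_gt0.
move=> s; rewrite ltr_pdivlMr// => hs; apply: hd; rewrite normrZ.
by apply: le_lt_trans hs; rewrite ler_wpM2l// lerDl.
Qed.

Lemma finite_eps (V : normedModType R) (I : finType) (Q : I -> V -> Prop) :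
  (forall i, exists2 d : R, 0 < d & forall h, `|h| < d -> Q i h) ->
  exists2 d : R, 0 < d & forall h, `|h| < d -> forall i, Q i h.
Proof.
move=> H; have hex i : exists d : R, 0 < d /\ forall h, `|h| < d -> Q i h.
  by have [d ? ?] := H i; exists d.
have [dd hdd] := boolp.choice hex.
exists (\big[Num.min/1]_i dd i).
  by apply/bigmin_gtP; split => // i _; have [] := hdd i.
move=> h hh i; apply: (hdd i).2; apply: lt_le_trans hh _.
exact: bigmin_le_cond.
Qed.

Lemma partial_mvt n (f : 'rV[R]_n.+1 -> R) i x (s : R) :
  (forall r, `|r| <= `|s| -> derivable f (x + r *: delta_mx 0 i) (delta_mx 0 i)) ->
  exists2 r, `|r| <= `|s| &
   f (x + s *: delta_mx 0 i) - f x = s * partial i f (x + r *: delta_mx 0 i).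
Proof.
move=> df; have [r|c c01 E] := @mvt01 (fun r => f (x + (r * s) *: delta_mx 0 i))
    (fun r => partial i f (x + (r * s) *: delta_mx 0 i) * s).
  move=> /andP[r0 r1]; apply: (@is_derive_scale (fun r => f (x + r *: delta_mx 0 i))).
  apply: derivable_line; apply: df.
  by rewrite normrM ler_piMl// ger0_norm.
move: c01 => /andP[c0 c1]; exists (c * s).
  by rewrite normrM ler_piMl// ger0_norm.
by rewrite mulrC -E mul1r mul0r scale0r addr0.
Qed.

(** Differentiability from continuity of the partial derivatives: go from x to
    x + h along the coordinate axes, one mean value theorem per axis. *)
Lemma C1_expand n (A : set 'rV[R]_n.+1) (f : 'rV[R]_n.+1 -> R) x : open A -> class_C 1 A f -> A x ->
  forall e, 0 < e -> exists2 d : R, 0 < d & forall h, `|h| < d ->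
    `|f (x + h) - f x - \sum_i h 0 i * partial i f x| <= e * `|h|.
Proof.
move=> oA fC Ax e e0; have [d0 d00 hA] := open_eps oA Ax.
pose e' := e / n.+1%:R; have e'0 : 0 < e' by rewrite divr_gt0.
have [d1 d10 h1] : exists2 d : R, 0 < d & forall h, `|h| < d -> forall i,
    `|partial i f (x + h) - partial i f x| <= e'.
  apply: finite_eps => i.
  exact: continuous_eps (class_C_continuous (class_C_S i fC) Ax) e'0.
exists (Num.min d0 d1); first by rewrite lt_min d00.
move=> h; rewrite lt_min => /andP[hd0 hd1].
(* p k is h with the coordinates from k on replaced by 0 *)
pose p (k : nat) : 'rV[R]_n.+1 := \row_(j < n.+1) (if (j < k)%N then h 0 j else 0).
have p0 : p 0%N = 0 by apply/rowP => j; rewrite !mxE.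
have pn : p n.+1 = h by apply/rowP => j; rewrite !mxE ltn_ord.
have pS (i : 'I_n.+1) : p i.+1 = p i + h 0 i *: delta_mx 0 i.
  apply/rowP => j; rewrite !mxE eqxx/= ltnS leq_eqVlt.
  have [->|ji] := eqVneq j i; first by rewrite eqxx ltnn/= mulr1 add0r.
  by rewrite -[_ == _ :> nat]/(j == i) (negbTE ji)/= mulr0 addr0.
have pnorm (i : 'I_n.+1) r : `|r| <= `|h 0 i| -> `|p i + r *: delta_mx 0 i| <= `|h|.
  move=> hr; apply: norm_le_entries => // j; rewrite !mxE eqxx/=.
  have [->|ji] := eqVneq j i.
    by rewrite ltnn add0r mulr1 (le_trans hr)// entry_le_norm.
  by rewrite mulr0 addr0; case: ifP => _; rewrite ?normr0// entry_le_norm.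
have step (i : 'I_n.+1) : `|f (x + p i.+1) - f (x + p i) - h 0 i * partial i f x| <= e' * `|h|.
  have [r|r hr E] := @partial_mvt n f i (x + p i) (h 0 i).
    move=> hr; apply: class_C_derivable fC _; rewrite -addrA; apply: hA.
    by apply: le_lt_trans hd0; exact: pnorm.
  rewrite pS addrA E -mulrBr normrM mulrC -addrA ler_pM//.
    by apply: h1; apply: le_lt_trans hd1; exact: pnorm.
  exact: entry_le_norm.
have tele : f (x + h) - f x = \sum_(i < n.+1) (f (x + p i.+1) - f (x + p i)).
  rewrite -(big_mkord xpredT (fun i => f (x + p i.+1) - f (x + p i))).
  by rewrite telescope_sumr// pn p0 addr0.
rewrite tele -sumrB; apply: le_trans (ler_norm_sum _ _ _) _.
apply: le_trans (ler_sum _ (fun i _ => step i)) _.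
rewrite sumr_const card_ord -mulr_natl mulrA.
by rewrite /e' mulrCA divff ?mulr1// pnatr_eq0.
Qed.

Definition dirder n (f : 'rV[R]_n.+1 -> R) (x v : 'rV[R]_n.+1) : R :=
  \sum_i v 0 i * partial i f x.

Lemma dirderZ n (f : 'rV[R]_n.+1 -> R) x c v : dirder f x (c *: v) = c * dirder f x v.
Proof. by rewrite /dirder mulr_sumr; apply: eq_bigr => i _; rewrite mxE mulrA. Qed.

Lemma dirderD n (f : 'rV[R]_n.+1 -> R) x v w :
  dirder f x (v + w) = dirder f x v + dirder f x w.
Proof. by rewrite /dirder -big_split; apply: eq_bigr => i _; rewrite mxE mulrDl. Qed.

Lemma dirder_delta n (f : 'rV[R]_n.+1 -> R) x i :
  dirder f x (delta_mx 0 i) = partial i f x.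
Proof.
rewrite /dirder (bigD1 i)//= big1 ?addr0; first by rewrite mxE !eqxx mul1r.
by move=> j ji; rewrite mxE (negbTE ji) andbF mul0r.
Qed.

Lemma C1_line_eps n (A : set 'rV[R]_n.+1) (f : 'rV[R]_n.+1 -> R) x v :
  open A -> class_C 1 A f -> A x ->
  forall e, 0 < e -> exists2 d : R, 0 < d & forall s : R, `|s| < d ->
    `|f (x + s *: v) - f x - dirder f x v * s| <= e * `|s|.
Proof.
move=> oA fC Ax e e0; have v0 : 0 < `|v| + 1 by rewrite ltr_wpDl.
have [d d0 hd] := C1_expand oA fC Ax (divr_gt0 e0 v0).
exists (d / (`|v| + 1)); first exact: divr_gt0.
move=> s; rewrite ltr_pdivlMr// => hs.
have sv : `|s *: v| <= `|s| * (`|v| + 1).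
  by rewrite normrZ ler_wpM2l// lerDl.
have := hd _ (le_lt_trans sv hs); rewrite -/(dirder f x (s *: v)) dirderZ [s * _]mulrC.
move/le_trans; apply.
apply: le_trans (ler_wpM2l (ltW (divr_gt0 e0 v0)) sv) _.
by rewrite mulrCA divfK// ?gt_eqF// mulrC.
Qed.

Lemma C1_is_derive n (A : set 'rV[R]_n.+1) (f : 'rV[R]_n.+1 -> R) x v (s : R) :
  open A -> class_C 1 A f -> A (x + s *: v) ->
  is_derive s 1 (fun r => f (x + r *: v)) (dirder f (x + s *: v) v).
Proof.
move=> oA fC Ax; apply: is_derive_eps => e e0.
have [d d0 hd] := C1_line_eps v oA fC Ax e0.
by exists d => // h hh; rewrite scalerDl addrA; exact: hd.
Qed.

(** Pointwise second-order expansion.  It is what a maximum point is tested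
    with, and it passes to sums and to square roots with no
    differentiability away from 0. *)
Definition jet2 (g : R -> R) (b c : R) := forall e, 0 < e ->
  exists2 d : R, 0 < d & forall s, `|s| < d ->
    `|g s - g 0 - b * s - c * s ^+ 2| <= e * s ^+ 2.

(** The mean value theorem applied to the remainder of g, whose derivative is the
    first-order remainder of g'. *)
Lemma jet2_derive (g g' : R -> R) (c d0 : R) : 0 < d0 ->
  (forall s : R, `|s| < d0 -> is_derive s 1 g (g' s)) ->
  (forall e, 0 < e -> exists2 d : R, 0 < d & forall s, `|s| < d ->
    `|g' s - g' 0 - 2 * c * s| <= e * `|s|) ->
  jet2 g (g' 0) c.
Proof.
move=> d00 dg dg' e e0; have [d d1 hd] := dg' e e0.
exists (Num.min d0 d); first by rewrite lt_min d00.
move=> s; rewrite lt_min => /andP[s0 s1].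
pose r x := g x - g' 0 * x - c * x ^+ 2.
have [x|x] := @mvt01 (fun x => r (x * s)) (fun x => (g' (x * s) - g' 0 - 2 * c * (x * s)) * s).
  move=> /andP[x0 x1]; apply: is_derive_scale.
  have := dg (x * s); rewrite normrM ger0_norm// => /(_ _)[].
    by apply: le_lt_trans s0; rewrite ler_piMl.
  move=> D1 D2; have D : is_derive (x * s) 1 g (g' (x * s)) by [].
  rewrite /r; apply: is_derive_eq.
  by rewrite /GRing.scale/= !(mulr1, mulr0, addr0, scaler0, add0r) /=; ring.
rewrite /r mul1r mul0r expr0n/= !mulr0 !subr0 => /andP[x0 x1] E.
have -> : g s - g 0 - g' 0 * s - c * s ^+ 2 = g s - g' 0 * s - c * s ^+ 2 - g 0.
  by ring.
rewrite E normrM.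
have xs : `|x * s| <= `|s| by rewrite normrM ger0_norm// ler_piMl.
have -> : e * s ^+ 2 = e * `|s| * `|s|.
  by rewrite -mulrA -normrM -expr2 ger0_norm ?sqr_ge0.
rewrite ler_wpM2r//.
apply: le_trans (hd _ (le_lt_trans xs s1)) _.
by rewrite ler_wpM2l// ltW.
Qed.

Lemma qform_hessian n (f : 'rV[R]_n.+1 -> R) x v :
  qform (hessian f x) v = \sum_i v 0 i * dirder (partial i f) x v.
Proof.
rewrite /qform mxE; apply: eq_bigr => j _; rewrite !mxE mulrC; congr (_ * _).
by rewrite /dirder; apply: eq_bigr => i _; rewrite mxE.
Qed.

Lemma C2_jet2 n (A : set 'rV[R]_n.+1) (f : 'rV[R]_n.+1 -> R) x v :
  open A -> class_C 2 A f -> A x ->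
  jet2 (fun s => f (x + s *: v)) (dirder f x v) (qform (hessian f x) v / 2).
Proof.
move=> oA fC Ax; have [d0 d00 hA] := open_line_eps v oA Ax.
have v0 : 0 < `|v| + 1 by rewrite ltr_wpDl.
have -> : dirder f x v = dirder f (x + 0 *: v) v by rewrite scale0r addr0.
apply: (@jet2_derive _ (fun s => dirder f (x + s *: v) v) _ d0) => //.
  by move=> s hs; apply: C1_is_derive oA (class_CW fC) _; exact: hA.
move=> e e0; pose e' := e / (n.+1%:R * (`|v| + 1)).
have e'0 : 0 < e' by rewrite divr_gt0// mulr_gt0.
have [d dp hd] : exists2 d : R, 0 < d & forall s : R, `|s| < d -> forall i,
    `|partial i f (x + s *: v) - partial i f x - dirder (partial i f) x v * s|
    <= e' * `|s|.
  apply: finite_eps => i; have [d dp hd] := C1_line_eps v oA (class_C_S i fC) Ax e'0.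
  by exists d.
exists d => // s /hd hs; rewrite scale0r addr0 qform_hessian mulrCA divff// mulr1.
rewrite /dirder -sumrB mulr_suml -sumrB; apply: le_trans (ler_norm_sum _ _ _) _.
have -> : e * `|s| = \sum_(i < n.+1) (`|v| + 1) * (e' * `|s|).
  rewrite sumr_const card_ord -mulr_natl /e'; field.
  by rewrite gt_eqF//= pnatr_eq0.
apply: ler_sum => i _; rewrite -mulrA -!mulrBr normrM ler_pM//.
by apply: le_trans (entry_le_norm _ _) _; rewrite lerDl.
Qed.

End Calculus.

Section MixedPartials.
Variable R : realType.

(** The mean value theorem in direction i turns the second difference into a
    difference of values of the i-th partial derivative, which is then expanded
    at x.  The second difference is symmetric in i and j, hence so is its limit:
    see [hessian_sym]. *)
Lemma mixed_difference n (A : set 'rV[R]_n.+1) (f : 'rV[R]_n.+1 -> R) x i j :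
  open A -> class_C 2 A f -> A x ->
  forall e, 0 < e -> exists2 d : R, 0 < d & forall s, 0 < s < d ->
    `|f (x + s *: delta_mx 0 i + s *: delta_mx 0 j) - f (x + s *: delta_mx 0 i)
      - f (x + s *: delta_mx 0 j) + f x - s ^+ 2 * partial j (partial i f) x|
    <= e * s ^+ 2.
Proof.
move=> oA fC Ax e e0; have [d0 d00 hA] := open_eps oA Ax.
have e3 : 0 < e / 3 by rewrite divr_gt0.
have [d d1 hd] := C1_expand oA (class_C_S i fC) Ax e3.
have hAd h : `|h| < Num.min d0 d -> A (x + h) /\ `|partial i f (x + h) - partial i f x
    - dirder (partial i f) x h| <= e / 3 * `|h|.
  by rewrite lt_min => /andP[h1 h2]; split; [exact: hA|exact: hd].
have m0 : 0 < Num.min d0 d by rewrite lt_min d00.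
exists (Num.min d0 d / 2); first by rewrite divr_gt0.
move=> s /andP[s0]; rewrite ltr_pdivlMr// => hs.
pose di : 'rV[R]_n.+1 := delta_mx 0 i; pose dj : 'rV[R]_n.+1 := delta_mx 0 j.
have nd k : `|delta_mx 0 k : 'rV[R]_n.+1| <= 1.
  apply: norm_le_entries => // l; rewrite mxE eqxx/=.
  by case: eqP; rewrite ?normr1 ?normr0.
have n1 c : 0 <= c <= 1 -> `|(c * s) *: di| <= s.
  move=> /andP[c0 c1]; rewrite normrZ normrM (ger0_norm c0) (gtr0_norm s0).
  by rewrite mulrAC ler_piMl// ?(ltW s0)// mulr_ile1// nd.
have n2 c : 0 <= c <= 1 -> `|(c * s) *: di + s *: dj| <= s * 2.
  move=> hc; apply: le_trans (ler_normD _ _) _.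
  rewrite mulr_natr mulr2n lerD ?n1// normrZ (gtr0_norm s0) ler_piMr ?nd// ltW//.
have s2 : s <= s * 2 by rewrite ler_peMr ?(ltW s0)// ler1n.
have [b hb|c hc] := @mvt01 R
  (fun c => f (x + s *: dj + (c * s) *: di) - f (x + (c * s) *: di))
  (fun c => partial i f (x + s *: dj + (c * s) *: di) * s
      - partial i f (x + (c * s) *: di) * s).
  have E1 : is_derive b 1 (fun c : R => f (x + s *: dj + (c * s) *: di))
      (partial i f (x + s *: dj + (b * s) *: di) * s).
    apply: (@is_derive_scale R (fun c => f (x + s *: dj + c *: di))).
    apply: derivable_line; apply: class_C_derivable fC _.
    rewrite -addrA [s *: dj + _]addrC; apply: (hAd _ _).1.
    by apply: le_lt_trans hs; exact: n2.
  have E2 : is_derive b 1 (fun c : R => f (x + (c * s) *: di))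
      (partial i f (x + (b * s) *: di) * s).
    apply: (@is_derive_scale R (fun c => f (x + c *: di))).
    apply: derivable_line; apply: class_C_derivable fC _.
    apply: (hAd _ _).1; apply: le_lt_trans hs; apply: le_trans s2; exact: n1.
  exact: is_deriveB.
rewrite mul1r mul0r scale0r !addr0 => E.
have {E} -> : f (x + s *: delta_mx 0 i + s *: delta_mx 0 j) - f (x + s *: delta_mx 0 i)
      - f (x + s *: delta_mx 0 j) + f x =
  partial i f (x + s *: dj + (c * s) *: di) * s - partial i f (x + (c * s) *: di) * s.
  by rewrite -E [x + s *: di + s *: dj]addrAC; ring.
have [_] := hAd _ (le_lt_trans (n2 c hc) hs).
have [_] := hAd _ (le_lt_trans (le_trans (n1 c hc) s2) hs).
rewrite dirderD !dirderZ !dirder_delta.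
have -> : x + s *: dj + (c * s) *: di = x + ((c * s) *: di + s *: dj).
  by rewrite -addrA [s *: dj + _]addrC.
move: (partial i f (x + (_ *: di + _))) (partial i f (x + _ *: di)) => b a.
move=> h1 h2.
have {}h1 : `|a - partial i f x - c * s * partial i (partial i f) x| <= e / 3 * s.
  by apply: le_trans h1 _; rewrite ler_wpM2l ?(ltW e3)// n1.
have {}h2 : `|b - partial i f x - (c * s * partial i (partial i f) x
      + s * partial j (partial i f) x)| <= e / 3 * (s * 2).
  by apply: le_trans h2 _; rewrite ler_wpM2l ?(ltW e3)// n2.
move: h1 h2; set P := partial i f x; set Q := partial i (partial i f) x.
set W := partial j (partial i f) x; move: P Q W => P Q W h1 h2.
have -> : b * s - a * s - s ^+ 2 * W =
  ((b - P - (c * s * Q + s * W)) - (a - P - c * s * Q)) * s by ring.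
rewrite normrM (gtr0_norm s0) expr2 mulrA ler_wpM2r ?(ltW s0)//.
apply: le_trans (ler_normB _ _) _; apply: le_trans (lerD h2 h1) _.
by rewrite le_eqVlt; apply/orP; left; apply/eqP; field.
Qed.

Lemma hessian_sym n (A : set 'rV[R]_n.+1) (f : 'rV[R]_n.+1 -> R) x :
  open A -> class_C 2 A f -> A x ->
  (hessian f x)^T = hessian f x.
Proof.
move=> oA fC Ax; apply/matrixP => j i; rewrite !mxE.
apply/eqP; rewrite -subr_eq0 -normr_le0; apply/ler_addgt0Pr => e e0; rewrite add0r.
have e2 : 0 < e / 2 by rewrite divr_gt0.
have [d1 d10 h1] := mixed_difference j i oA fC Ax e2.
have [d2 d20 h2] := mixed_difference i j oA fC Ax e2.
pose s := Num.min d1 d2 / 2.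
have m0 : 0 < Num.min d1 d2 by rewrite lt_min d10.
have s0 : 0 < s by rewrite divr_gt0.
have sm : s < Num.min d1 d2 by rewrite /s; lra.
have := sm; rewrite lt_min => /andP[s1 s2].
have := h1 s; rewrite s0 s1 => /(_ isT).
have := h2 s; rewrite s0 s2 => /(_ isT).
rewrite [x + s *: delta_mx 0 j + _]addrAC.
move: (f _) (f _) (f _) (f _) => a b c g k1 k2.
have s20 : 0 < s ^+ 2 by rewrite exprn_gt0.
rewrite -(ler_pM2r s20) -[X in `|_| * X](gtr0_norm s20) -normrM.
move: k1 k2; set P := partial i _ x; set Q := partial j _ x.
move: P Q => P Q k1 k2.
have -> : (P - Q) * s ^+ 2 =
   (g - c - b + a - s ^+ 2 * Q) - (g - b - c + a - s ^+ 2 * P) by ring.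
apply: le_trans (ler_normB _ _) _. apply: le_trans (lerD k1 k2) _.
by rewrite -mulrDl -splitr.
Qed.

End MixedPartials.

(** * The equation and its linear algebra *)

Section Equation.
Variable R : realType.

Let o0 : 'I_3 := ord0.
Let o1 : 'I_3 := lift ord0 ord0.
Let o2 : 'I_3 := lift ord0 (lift ord0 ord0).

Lemma det2E (A : 'M[R]_2) : \det A = A 0 0 * A 1 1 - A 0 1 * A 1 0.
Proof.
rewrite (expand_det_row _ 0) !big_ord_recl big_ord0 addr0 /cofactor !det_mx11 !mxE /=.
have e01 : lift 0 (0 : 'I_1) = 1 :> 'I_2 by apply: val_inj.
have e10 : lift (1 : 'I_2) (0 : 'I_1) = 0 :> 'I_2 by apply: val_inj.
rewrite -/(0 : 'I_1) !(e01, e10) /bump /= expr0 expr1; ring.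
Qed.

Lemma det3E (A : 'M[R]_3) : \det A =
  A o0 o0 * (A o1 o1 * A o2 o2 - A o1 o2 * A o2 o1)
  - A o0 o1 * (A o1 o0 * A o2 o2 - A o1 o2 * A o2 o0)
  + A o0 o2 * (A o1 o0 * A o2 o1 - A o1 o1 * A o2 o0).
Proof.
rewrite (expand_det_row _ o0) sum3 /cofactor !det2E !mxE /=.
have e01 : lift o0 (0 : 'I_2) = o1 by apply: val_inj.
have e02 : lift o0 (1 : 'I_2) = o2 by apply: val_inj.
have e10 : lift o1 (0 : 'I_2) = o0 by apply: val_inj.
have e12 : lift o1 (1 : 'I_2) = o2 by apply: val_inj.
have e20 : lift o2 (0 : 'I_2) = o0 by apply: val_inj.
have e21 : lift o2 (1 : 'I_2) = o1 by apply: val_inj.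
rewrite -/o0 -/o1 -/o2 !(e01, e02, e10, e12, e20, e21) /bump /= !expr0 !expr1.
ring.
Qed.

Lemma char_poly_horner n (A : 'M[R]_n) x : (char_poly A).[x] = \det (x%:M - A).
Proof.
rewrite /char_poly -horner_evalE -det_map_mx; congr (\det _).
apply/matrixP => i j; rewrite !mxE /= horner_evalE !hornerE.
by rewrite hornerMn hornerX.
Qed.

(** [eigenvalues] is the zero vector when the characteristic polynomial does not
    split, and then S2 would be 0.  So the polynomial splits, and comparing
    its values at 0, 1 and -1 yields the elementary symmetric functions. *)
Lemma S_of_S2 (M : 'M[R]_3) : S2 M = 1 -> sigma2 M = 1 /\ S1 M = \tr M.
Proof.
rewrite /S2 /S1; set l := eigenvalues M => hS.
have hl : char_poly M = \prod_(i < 3) ('X - (l 0 i)%:P).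
  rewrite /l /eigenvalues; case: xgetP => [y -> //|none].
  move: hS; rewrite /l /eigenvalues; case: xgetP => [y _ /none//|_].
  rewrite big1 => [/eqP|i _]; first by rewrite eq_sym oner_eq0.
  by rewrite big1// => j _; rewrite !mxE mul0r.
have ev x : \det (x%:M - M) = (x - l 0 o0) * (x - l 0 o1) * (x - l 0 o2).
  rewrite -char_poly_horner hl !big_ord_recl big_ord0 mulr1 mulrA !hornerE.
  by [].
have hS' : l 0 o0 * l 0 o1 + l 0 o0 * l 0 o2 + l 0 o1 * l 0 o2 = 1.
  rewrite -hS; transitivity (\sum_(i < 3) \sum_(j < 3)
      (if (i < j)%N then l 0 i * l 0 j else 0)).
    by rewrite !sum3 /=; lra.
  by apply: eq_bigr => i _; rewrite -big_mkcond.
have [h0 [h1 h2]] := (ev 0, (ev 1, ev (-1))).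
move: h0 h1 h2; rewrite !det3E !mxE /= -/o0 -/o1 -/o2 => h0 h1 h2.
have htr : \tr M = M o0 o0 + M o1 o1 + M o2 o2 by rewrite /mxtrace sum3.
have htr2 : \tr (M *m M) = M o0 o0 ^+ 2 + M o1 o1 ^+ 2 + M o2 o2 ^+ 2
   + 2 * (M o0 o1 * M o1 o0 + M o0 o2 * M o2 o0 + M o1 o2 * M o2 o1).
  by rewrite /mxtrace sum3 !mxE !sum3; ring.
rewrite /sigma2 htr htr2 sum3; split; first lra.
lra.
Qed.

(** (tr H)^2 = tr (H^2) + 2 sigma2 H >= 2. *)
Lemma hessian_trace_gt1 (H : 'M[R]_3) : H^T = H -> 0 < \tr H -> sigma2 H = 1 ->
  1 < \tr H.
Proof.
move=> Hs H0; rewrite /sigma2 => h.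
have := mxtrace_sqr_ge0 Hs => h2; rewrite ltNge; apply/negP => h1.
have : (\tr H) ^+ 2 <= 1 by rewrite exprn_ile1// ltW.
lra.
Qed.

End Equation.

Section SecondOrderJets.
Variable R : realType.
Implicit Types (g h : R -> R) (b c k : R).

Lemma jet2D g b c h b' c' : jet2 g b c -> jet2 h b' c' ->
  jet2 (fun s => g s + h s) (b + b') (c + c').
Proof.
move=> G H e e0; have e2 : 0 < e / 2 by rewrite divr_gt0.
have [d d0 hd] := G _ e2; have [d' d0' hd'] := H _ e2.
exists (Num.min d d'); first by rewrite lt_min d0.
move=> s; rewrite lt_min => /andP[s1 s2].
have -> : g s + h s - (g 0 + h 0) - (b + b') * s - (c + c') * s ^+ 2 =
  (g s - g 0 - b * s - c * s ^+ 2) + (h s - h 0 - b' * s - c' * s ^+ 2) by ring.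
apply: le_trans (ler_normD _ _) _; apply: le_trans (lerD (hd _ s1) (hd' _ s2)) _.
by rewrite -mulrDl -splitr.
Qed.

Lemma jet2Z k g b c : jet2 g b c -> jet2 (fun s => k * g s) (k * b) (k * c).
Proof.
move=> G e e0; have k0 : 0 < `|k| + 1 by rewrite ltr_wpDl.
have [d d0 hd] := G _ (divr_gt0 e0 k0).
exists d => // s hs.
have -> : k * g s - k * g 0 - k * b * s - k * c * s ^+ 2 =
  k * (g s - g 0 - b * s - c * s ^+ 2) by ring.
rewrite normrM; apply: le_trans (ler_wpM2l (normr_ge0 k) (hd _ hs)) _.
rewrite mulrA ler_wpM2r ?sqr_ge0// mulrCA ler_piMr ?(ltW e0)//.
by rewrite ler_pdivrMr// mul1r lerDl.
Qed.

Lemma jet2_sum (I : finType) (P : pred I) (g : I -> R -> R) (b c : I -> R) :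
  (forall i, P i -> jet2 (g i) (b i) (c i)) ->
  jet2 (fun s => \sum_(i | P i) g i s) (\sum_(i | P i) b i) (\sum_(i | P i) c i).
Proof.
move=> H; have := @big_ind3 (R -> R) R R (fun g b c => jet2 g b c)
  (fun=> 0) (fun g h s => g s + h s) 0 +%R 0 +%R.
move=> /(_ _ _ I (index_enum I) P g b c).
have -> : (fun s => \sum_(i | P i) g i s) =
    \big[(fun (g h : R -> R) s => g s + h s)/(fun=> 0)]_(i | P i) g i.
  apply/funext => s; elim/big_rec2: _ => // i x y _ ->.
  by [].
apply => //.
- by move=> e e0; exists 1 => // s _; rewrite !mul0r !subr0 normr0 mulr_ge0 ?sqr_ge0// ltW.
- by move=> *; exact: jet2D.
Qed.

Lemma jet2_quad k b c : jet2 (fun s => k + b * s + c * s ^+ 2) b c.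
Proof.
move=> e e0; exists 1 => // s _; rewrite expr0n/= !mulr0 !addr0.
have -> : k + b * s + c * s ^+ 2 - k - b * s - c * s ^+ 2 = 0 by ring.
by rewrite normr0 mulr_ge0 ?sqr_ge0// ltW.
Qed.

Lemma jet2_eq g b c b' c' : jet2 g b c -> b = b' -> c = c' -> jet2 g b' c'.
Proof. by move=> ? <- <-. Qed.

Lemma jet2_lipschitz g b c : jet2 g b c ->
  exists2 K : R, 0 < K & exists2 d : R, 0 < d &
    forall s, `|s| < d -> `|g s - g 0| <= K * `|s|.
Proof.
move=> G; have [d d0 hd] := G 1 ltr01.
exists (`|b| + `|c| + 1); first by rewrite ltr_wpDl// addr_ge0.
exists (Num.min d 1); first by rewrite lt_min d0 ltr01.
move=> s; rewrite lt_min => /andP[s1 s2].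
have -> : g s - g 0 = (g s - g 0 - b * s - c * s ^+ 2) + (b + c * s) * s by ring.
apply: le_trans (ler_normD _ _) _; rewrite normrM.
have h1 : `|g s - g 0 - b * s - c * s ^+ 2| <= 1 * `|s|.
  apply: le_trans (hd _ s1) _; rewrite !mul1r -[leLHS]ger0_norm ?sqr_ge0//.
  by rewrite normrX expr2 ler_piMl// ltW.
have h2 : `|b + c * s| * `|s| <= (`|b| + `|c|) * `|s|.
  rewrite ler_wpM2r//; apply: le_trans (ler_normD _ _) _.
  by rewrite lerD2l normrM ler_piMr// ltW.
by apply: le_trans (lerD h1 h2) _; rewrite -mulrDl [1 + _]addrC.
Qed.

(** If b were not 0, the linear term would dominate in the direction where it is
    positive. *)
Lemma jet2_max g b c : jet2 g b c ->
  (exists2 d : R, 0 < d & forall s, `|s| < d -> g s <= g 0) -> b = 0 /\ c <= 0.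
Proof.
move=> G [d d0 hd].
have H e : 0 < e -> exists2 r : R, 0 < r & forall s, `|s| < r ->
    b * s + c * s ^+ 2 <= e * s ^+ 2.
  move=> e0; have [r r0 hr] := G e e0.
  exists (Num.min d r); first by rewrite lt_min d0.
  move=> s; rewrite lt_min => /andP[s1 s2].
  have := hr s s2; have := hd s s1; rewrite ler_norml => h1 /andP[h2 _].
  lra.
have b0 : b = 0.
  apply/eqP; apply: contraT => bn.
  have bp : 0 < `|b| by rewrite normr_gt0.
  have [r r0 hr] := H 1 ltr01.
  have C0 : 0 < 1 + `|c| by rewrite ltr_pwDl.
  pose q := Num.min (r / 2) (`|b| / (2 * (1 + `|c|))).
  have q0 : 0 < q by rewrite lt_min !divr_gt0// mulr_gt0.
  have qr : q < r by apply: (@le_lt_trans _ _ (r / 2)); [rewrite ge_min lexx|lra].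
  have qb : q * (1 + `|c|) <= `|b| / 2.
    rewrite -ler_pdivlMr// ge_min; apply/orP; right.
    by rewrite le_eqVlt; apply/orP; left; apply/eqP; field; rewrite gt_eqF.
  have sg (s : R) : `|s| = 1 -> b * s = `|b| -> False.
    move=> s1 bs; have := hr (s * q).
    rewrite normrM s1 gtr0_norm// [1 * q]mul1r => /(_ qr); rewrite mulrA bs exprMn.
    have -> : s ^+ 2 = 1 by rewrite -[s ^+ 2]ger0_norm ?sqr_ge0// normrX s1 expr1n.
    rewrite !mul1r => h.
    have : `|b| * q <= (1 - c) * q * q by rewrite mulrBl mulrBl -!mulrA -expr2; lra.
    rewrite ler_pM2r// => h'.
    have : (1 - c) * q <= q * (1 + `|c|).
      by rewrite mulrC ler_pM2l// lerD2l -normrN ler_norm.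
    lra.
  have [b1|b1] := lerP 0 b.
    exfalso; apply: (sg 1); first exact: normr1.
    by rewrite mulr1 ger0_norm.
  exfalso; apply: (sg (-1)); first by rewrite normrN normr1.
  by rewrite mulrN1 ltr0_norm.
split => //; apply/ler_addgt0Pr => e e0; rewrite add0r.
have [r r0 hr] := H e e0; have r20 : 0 < r / 2 by rewrite divr_gt0.
have := hr (r / 2); rewrite gtr0_norm// b0 mul0r add0r ler_pM2r ?exprn_gt0//.
by apply; lra.
Qed.

(** The polynomial P = a - b' s - c' s^2 satisfies P^2 = - g + o(s^2), and
    |sqrt (-g) - P| <= |- g - P^2| / (sqrt (-g) + P) with P bounded below.  Where g
    happens to be positive, the square root is 0, which is still closer to P^2
    after squaring than - g is. *)
Lemma jet2_sqrt g b c : jet2 g b c -> g 0 < 0 ->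
  let a := Num.sqrt (- g 0) in
  jet2 (fun s => - Num.sqrt (- g s)) (b / (2 * a)) ((c + (b / (2 * a)) ^+ 2) / (2 * a)).
Proof.
move=> G g0 a; have a0 : 0 < a by rewrite sqrtr_gt0 oppr_gt0.
have a2 : a ^+ 2 = - g 0 by rewrite sqr_sqrtr// oppr_ge0 ltW.
set b' := b / (2 * a); set c' := (c + b' ^+ 2) / (2 * a) => e e0.
have bE : b = 2 * a * b' by rewrite /b'; field; rewrite gt_eqF.
have cE : c = 2 * a * c' - b' ^+ 2 by rewrite /c'; field; rewrite gt_eqF.
pose K := 2 * `|b' * c'| + c' ^+ 2 + 1.
have K0 : 0 < K by rewrite ltr_wpDl// addr_ge0 ?sqr_ge0// mulr_ge0.
pose L := `|b'| + `|c'| + 1.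
have L0 : 0 < L by rewrite ltr_wpDl// addr_ge0.
have ea : 0 < e * a / 4 by rewrite divr_gt0// mulr_gt0.
have [d d0 hd] := G _ ea.
pose r := Num.min (Num.min d 1) (Num.min (e * a / 4 / K) (a / 2 / L)).
have r0 : 0 < r by rewrite !lt_min d0 ltr01/= !divr_gt0// mulr_gt0.
exists r => // s; rewrite !lt_min => /andP[/andP[s1 s2] /andP[s3 s4]].
rewrite ltr_pdivlMr// in s3; rewrite ltr_pdivlMr// in s4.
have := hd s s1; rewrite -/a; set h := Num.sqrt (- g s).
pose P := a - b' * s - c' * s ^+ 2.
have Pa : a / 2 <= P.
  have : `|b' * s + c' * s ^+ 2| <= `|s| * L.
    apply: le_trans (ler_normD _ _) _.
    rewrite [`|b' * s|]normrM [`|c' * _|]normrM.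
    have hs : `|c'| * `|s ^+ 2| <= `|s| * `|c'|.
      by rewrite mulrC ler_wpM2r// normrX expr2 ler_piMl// ltW.
    apply: le_trans (lerD (lexx _) hs) _; rewrite [`|b'| * _]mulrC -mulrDr.
    by rewrite ler_wpM2l// /L lerDl.
  rewrite /P ler_norml => /andP[_ h2]; lra.
move=> hrho.
have h1 : `|- g s - P ^+ 2| <= e * a / 2 * s ^+ 2.
  have -> : - g s - P ^+ 2 = - (g s - g 0 - b * s - c * s ^+ 2)
    - (2 * (b' * c') + c' ^+ 2 * s) * s * s ^+ 2.
    by rewrite bE cE -[g 0]opprK -a2 /P; ring.
  apply: le_trans (ler_normB _ _) _; rewrite normrN.
  have h2 : `|(2 * (b' * c') + c' ^+ 2 * s) * s * s ^+ 2| <= e * a / 4 * s ^+ 2.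
    rewrite normrM [`|s ^+ 2|]ger0_norm ?sqr_ge0// ler_wpM2r ?sqr_ge0// normrM.
    apply: (le_trans _ (ltW s3)); rewrite mulrC ler_wpM2l//.
    apply: le_trans (ler_normD _ _) _; rewrite /K normrM [`|2|]gtr0_norm//.
    rewrite -addrA lerD2l normrM normrX -[c' ^+ 2]ger0_norm ?sqr_ge0// normrX.
    by apply: ler_wpDr => //; rewrite ler_piMr ?sqr_ge0// ltW.
  by apply: le_trans (lerD hrho h2) _; lra.
have h2 : `|h ^+ 2 - P ^+ 2| <= `|- g s - P ^+ 2|.
  have [gs|gs] := lerP 0 (- g s); first by rewrite sqr_sqrtr.
  rewrite /h (ler0_sqrtr (ltW gs)) expr0n/= sub0r normrN.
  rewrite ger0_norm ?sqr_ge0// ler0_norm; first lra.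
  by have := sqr_ge0 P; lra.
have h3 : 0 <= h by exact: sqrtr_ge0.
have -> : - h - - a - b' * s - c' * s ^+ 2 = P - h by rewrite /P; ring.
have hP : 0 < h + P by lra.
rewrite distrC -(ler_pM2r hP) -[X in `|_| * X](gtr0_norm hP) -normrM.
have -> : (h - P) * (h + P) = h ^+ 2 - P ^+ 2 by ring.
apply: le_trans h2 (le_trans h1 _).
have -> : e * a / 2 * s ^+ 2 = e * s ^+ 2 * (a / 2) by ring.
apply: ler_wpM2l; last exact: ler_wpDl.
by rewrite mulr_ge0 ?sqr_ge0 ?(ltW e0).
Qed.

End SecondOrderJets.

(** * Maximum principle and behaviour at the boundary *)

Section DotProd.
Variables (R : realType) (n : nat).
Implicit Types u v w : 'rV[R]_n.

Lemma dotprodE u v : dotprod u v = (u *m v^T) 0 0.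
Proof. by rewrite mxE; apply: eq_bigr => i _; rewrite mxE. Qed.

Lemma dotprodC u v : dotprod u v = dotprod v u.
Proof. by apply: eq_bigr => i _; rewrite mulrC. Qed.

Lemma dotprodDl u v w : dotprod (u + v) w = dotprod u w + dotprod v w.
Proof. by rewrite !dotprodE mulmxDl mxE. Qed.

Lemma dotprodZl k u w : dotprod (k *: u) w = k * dotprod u w.
Proof. by rewrite !dotprodE -scalemxAl mxE. Qed.

Lemma dotprodDr u v w : dotprod w (u + v) = dotprod w u + dotprod w v.
Proof. by rewrite !(dotprodC w) dotprodDl. Qed.

Lemma dotprodZr k u w : dotprod w (k *: u) = k * dotprod w u.
Proof. by rewrite !(dotprodC w) dotprodZl. Qed.

Lemma dotprod_deltal i w : dotprod (delta_mx 0 i) w = w 0 i.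
Proof.
rewrite /dotprod (bigD1 i)//= big1 ?addr0; first by rewrite mxE !eqxx mul1r.
by move=> j ji; rewrite mxE (negbTE ji) andbF mul0r.
Qed.

Lemma dotprod0l w : dotprod 0 w = 0.
Proof. by rewrite dotprodE mul0mx mxE. Qed.

Lemma dotprod_ge0 u : 0 <= dotprod u u.
Proof. by apply: sumr_ge0 => i _; rewrite -expr2 sqr_ge0. Qed.

Lemma dotprod_gt0 u : u != 0 -> 0 < dotprod u u.
Proof.
by move=> /qform1_gt0; rewrite /qform mulmx1 dotprodE.
Qed.

Lemma norm_sqr_le_dotprod u : `|u| ^+ 2 <= dotprod u u.
Proof.
rewrite -[leRHS]sqr_sqrtr ?dotprod_ge0// lerXn2r ?nnegrE ?sqrtr_ge0//.
apply: norm_le_entries => [|i]; first exact: sqrtr_ge0.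
rewrite -sqrtr_sqr ler_wsqrtr// /dotprod (bigD1 i)//= -expr2 lerDl.
by apply: sumr_ge0 => j _; rewrite -expr2 sqr_ge0.
Qed.

Lemma dotprod_le_norm u v : dotprod u v <= n%:R * (`|u| * `|v|).
Proof.
apply: le_trans (ler_norm _) _; apply: le_trans (ler_norm_sum _ _ _) _.
rewrite mulr_natl -[X in _ *+ X](card_ord n) -sumr_const; apply: ler_sum => i _.
by rewrite normrM ler_pM// entry_le_norm.
Qed.

End DotProd.

Section Topology.
Variable R : realType.

Lemma bounded_by n (A : set 'rV[R]_n) : bounded_set A ->
  exists M, forall x, A x -> `|x| <= M.
Proof. by move=> [M [_ h]]; exists (M + 1) => x Ax; apply: (h (M + 1)) => //; rewrite ltrDl. Qed.

Lemma bounded_by_set n (A : set 'rV[R]_n) M :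
  (forall x, A x -> `|x| <= M) -> bounded_set A.
Proof.
move=> h; exists M; split; first exact: num_real.
by move=> M' MM' x Ax; exact: le_trans (h x Ax) (ltW MM').
Qed.

Lemma bounded_closure n (A : set 'rV[R]_n) : bounded_set A -> bounded_set (closure A).
Proof.
move=> /bounded_by[M hM]; apply: (@bounded_by_set _ _ M).
have cl : closed [set x : 'rV[R]_n | `|x| <= M].
  apply: (@preimage_closed _ _ (fun x : 'rV[R]_n => `|x|) [set y | y <= M]).
    by move=> x _; exact: norm_continuous.
  exact: closed_le.
move=> x /(closure_subset (hM : A `<=` [set x : 'rV[R]_n | `|x| <= M])).
by rewrite -((closure_id [set x : 'rV[R]_n | `|x| <= M]).1 cl).
Qed.

Lemma bounded_compact_closure n (A : set 'rV[R]_n) :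
  bounded_set A -> compact (closure A).
Proof.
move=> bA; apply: bounded_closed_compact; first exact: bounded_closure.
exact: closed_closure.
Qed.

Lemma open_boundary (T : topologicalType) (A : set T) x : open A ->
  boundary A x <-> closure A x /\ ~ A x.
Proof. by move=> /interior_id e; rewrite /boundary e. Qed.

Lemma within_comp (S T U : topologicalType) (B : set S) (A : set T) (g : S -> T)
    (f : T -> U) : {within A, continuous f} -> continuous g ->
  (forall x, B x -> A (g x)) -> {within B, continuous (f \o g)}.
Proof.
move=> /subspace_continuousP cf cg BA; apply/subspace_continuousP => x Bx.
apply: (cvg_comp _ _ _ (cf (g x) (BA x Bx))).
move=> P wP; have := cg x _ wP; rewrite /within/= /nbhs/=.
by apply: filterS => y /= h By; apply/h/BA.
Qed.

Lemma continuous_sum (T : topologicalType) (U : normedModType R) (I : finType)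
    (f : I -> T -> U) :
  (forall i, continuous (f i)) -> continuous (fun x => \sum_i f i x).
Proof.
move=> cf x.
apply: (@cvg_big U I (fun a b : U => a + b) 0 xpredT) => [|i _]; last exact: cf.
exact: (@add_continuous U).
Qed.

Lemma barrier_continuous n (p m : 'rV[R]_n) :
  continuous (fun x : 'rV[R]_n => dotprod (x - p) (x - p) - 2 * dotprod (x - p) m).
Proof.
have cc i : continuous (fun x : 'rV[R]_n => (x - p) 0 i).
  have -> : (fun x : 'rV[R]_n => (x - p) 0 i) = (fun x => x 0 i - p 0 i).
    by apply/funext => y; rewrite !mxE.
  move=> x; exact: (cvgB (@coord_continuous R 1 n 0 i x) (cvg_cst (p 0 i))).
have c1 : continuous (fun x : 'rV[R]_n => dotprod (x - p) (x - p)).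
  rewrite /dotprod; apply: continuous_sum => i y.
  exact: (cvgM (cc i y) (cc i y)).
have c2 : continuous (fun x : 'rV[R]_n => dotprod (x - p) m).
  rewrite /dotprod; apply: continuous_sum => i y.
  exact: (cvgM (cc i y) (cvg_cst (m 0 i))).
by move=> x; exact: (cvgB (c1 x) (cvgM (cvg_cst (2 : R)) (c2 x))).
Qed.

End Topology.

Section Solution.
Variable R : realType.
Implicit Types (Om : set 'rV[R]_3) (u : 'rV[R]_3 -> R).

Lemma trace_hessian Om u x : open Om -> admissible_solution Om u -> Om x ->
  [/\ (hessian u x)^T = hessian u x, sigma2 (hessian u x) = 1 & 1 < \tr (hessian u x)].
Proof.
move=> oO [[uC adm] _ hS _] Ox; have Hs := hessian_sym oO uC Ox.
have [h2 h1] := S_of_S2 (hS x Ox).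
split => //; apply: hessian_trace_gt1 => //.
by rewrite -h1; have [] := adm x Ox.
Qed.

(** For k > 0 this vanishes on the sphere of centre p + m through p, and it
    has Laplacian 6 k. *)
Definition barrier (k : R) (p m x : 'rV[R]_3) : R :=
  k * (dotprod (x - p) (x - p) - 2 * dotprod (x - p) m).

(** The Laplacian of u exceeds 1, hence that of the barrier. *)
Lemma no_interior_max Om u k p m x : open Om -> admissible_solution Om u ->
  Om x -> 6 * k <= 1 ->
  ~ (exists2 d : R, 0 < d & forall h, `|h| < d ->
      u (x + h) - barrier k p m (x + h) <= u x - barrier k p m x).
Proof.
move=> oO us Ox k1 [d d0 hd].
have [Hs _ Ht] := trace_hessian oO us Ox; have [[uC _] _ _ _] := us.
suff : \tr (hessian u x) <= 6 * k by lra.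
have -> : 6 * k = \sum_(i < 3) 2 * k.
  by rewrite sumr_const card_ord -mulr_natl; ring.
apply: ler_sum => i _.
pose e : 'rV[R]_3 := delta_mx 0 i.
have j1 := C2_jet2 e oO uC Ox.
have j2 := jet2_quad (barrier k p m x) (k * 2 * (dotprod e (x - p) - dotprod e m)) k.
have /jet2_max[] := jet2D j1 (jet2Z (-1) j2).
  exists d => // s hs; rewrite scale0r addr0 expr0n/= !mulr0 !addr0 !mulN1r.
  have : `|s *: e| < d.
    apply: le_lt_trans hs; rewrite normrZ ler_piMr//.
    apply: norm_le_entries => // l; rewrite mxE eqxx/=.
    by case: eqP; rewrite ?normr1 ?normr0.
  move/hd; congr (_ - _ <= _).
  rewrite /barrier addrAC; move: (x - p) => y.
  rewrite !(dotprodDl, dotprodDr) !(dotprodZl, dotprodZr).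
  have -> : dotprod e e = 1 by rewrite dotprod_deltal mxE !eqxx.
  by rewrite [dotprod y e]dotprodC; ring.
move=> _; have -> : qform (hessian u x) e = hessian u x i i.
  rewrite qform_hessian (bigD1 i)//= big1 ?addr0.
    by rewrite /e dirder_delta !mxE !eqxx mul1r.
  by move=> j ji; rewrite mxE (negbTE ji) andbF mul0r.
lra.
Qed.

End Solution.

Section BoundaryBehaviour.
Variable R : realType.
Implicit Types (Om : set 'rV[R]_3) (u : 'rV[R]_3 -> R).

Lemma solution_lt0 Om u : open Om -> bounded_set Om -> admissible_solution Om u ->
  forall x, Om x -> u x < 0.
Proof.
move=> oO bO us x Ox; have [_ cu _ ub] := us.
have [c /set_mem clc hc] := @compact_EVT_max _ R u (closure Om)
  (ex_intro _ x (subset_closure Ox)) (bounded_compact_closure bO) cu.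
have no_max y : Om y -> (forall z, Om z -> u z <= u y) -> False.
  move=> Oy hy; have k0 : 6 * 0 <= 1 :> R by rewrite mulr0.
  apply: (no_interior_max oO us Oy k0 (p := 0) (m := 0)).
  have [d d0 hd] := open_eps oO Oy.
  by exists d => // h /hd Oyh; rewrite /barrier !mul0r !subr0 hy.
have le_c z : Om z -> u z <= u c by move=> Oz; apply/hc/mem_set/subset_closure.
have c0 : u c = 0.
  by apply: ub; apply/open_boundary => //; split => // Oc; exact: (no_max c).
rewrite ltNge; apply/negP => ux0; apply: (no_max x Ox) => z /le_c zc.
by apply: le_trans zc _; rewrite c0.
Qed.

(** At a maximum of u - barrier over the closed ball, the point is not interior
    to the ball, so the barrier vanishes there while u is nonpositive. *)
Lemma interior_ball_barrier Om u p m : open Om -> bounded_set Om ->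
  admissible_solution Om u -> closure Om p -> ~ Om p ->
  (forall x, x != p -> dotprod (x - p) (x - p) <= 2 * dotprod (x - p) m -> Om x) ->
  forall x, dotprod (x - p) (x - p) <= 2 * dotprod (x - p) m ->
    u x <= barrier 6^-1 p m x.
Proof.
move=> oO bO us clp nOp hball.
have [_ cu _ ub] := us.
have up : u p = 0 by apply: ub; apply/open_boundary.
pose F x := dotprod (x - p) (x - p) - 2 * dotprod (x - p) m.
have cF : continuous F by exact: barrier_continuous.
pose K := [set x | F x <= 0].
have inK x : dotprod (x - p) (x - p) <= 2 * dotprod (x - p) m -> K x.
  by rewrite /K /= /F subr_le0.
have Kcl : closed K.
  apply: (@preimage_closed _ _ F [set y | y <= 0]); last exact: closed_le.
  by move=> x _; exact: cF.
have KO x : K x -> x = p \/ Om x.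
  rewrite /K /= /F subr_le0 => Kx; have [->|xp] := eqVneq x p; first by left.
  by right; exact: hball.
have Kb : bounded_set K.
  apply: (@bounded_by_set _ _ _ (6 * `|m| + `|p|)) => x.
  rewrite /K /= /F subr_le0 => h.
  rewrite -[x](subrK p); apply: le_trans (ler_normD _ _) _; rewrite lerD2r.
  move: (x - p) h => y h; have [->|y0] := eqVneq y 0.
    by rewrite normr0 mulr_ge0.
  have yp : 0 < `|y| by rewrite normr_gt0.
  rewrite -(ler_pM2l yp) -expr2; apply: le_trans (norm_sqr_le_dotprod _) _.
  apply: le_trans h _; have := dotprod_le_norm y m; lra.
have Kc := bounded_closed_compact Kb Kcl.
have Fp0 : F p = 0 by rewrite /F subrr !dotprod0l mulr0 subrr.
have Kp : K p by rewrite /K /= Fp0.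
have cf : {within K, continuous (fun x => u x - barrier 6^-1 p m x)}.
  apply/subspace_continuousP => x Kx; apply: cvgB.
    apply: (iffLR (@subspace_continuousP _ K _ u)) => //.
    apply: continuous_subspaceW cu => y /KO[->//|]; exact: subset_closure.
  apply: cvg_within_filter; apply: cvgM; first exact: cvg_cst.
  exact: cF.
have [c /set_mem Kc' hc] := @compact_EVT_max _ R _ K (ex_intro _ p Kp) Kc cf.
move=> x /inK Kx; rewrite -subr_le0; apply: le_trans (hc x (mem_set Kx)) _.
have barE y : barrier 6^-1 p m y = 6^-1 * F y by [].
have [->|Oc] := KO c Kc'.
  by rewrite up barE Fp0 mulr0 subrr.
have uc := solution_lt0 oO bO us Oc.
have [Fc|Fc] := ltrP (F c) 0; last first.
  have Fc0 : F c = 0 by apply/eqP; rewrite eq_le Fc andbT; exact: Kc'.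
  rewrite barE Fc0 mulr0.
  by rewrite subr0 ltW.
exfalso; have k1 : 6 * 6^-1 <= 1 :> R by rewrite divff.
apply: (no_interior_max oO us Oc k1 (p := p) (m := m)).
have e0 : 0 < - F c by rewrite oppr_gt0.
have [d d0 hd] := continuous_eps (cF c) e0.
exists d => // h /hd; rewrite ler_norml => /andP[_ h2].
by apply/hc/mem_set; rewrite /K /=; lra.
Qed.

(** Along the inner normal the barrier is at most - s |m|^2 / 6, so - u grows at
    least linearly and its root has infinite slope. *)
Lemma root_steep Om u p m : open Om -> bounded_set Om ->
  admissible_solution Om u -> closure Om p -> ~ Om p -> m != 0 ->
  (forall x, x != p -> dotprod (x - p) (x - p) <= 2 * dotprod (x - p) m -> Om x) ->
  exists2 k : R, 0 < k & forall s, 0 < s <= 1 ->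
    Om (p + s *: m) /\ - Num.sqrt (- u (p + s *: m)) <= - Num.sqrt (k * s).
Proof.
move=> oO bO us clp nOp m0 hball; have mm := dotprod_gt0 m0.
exists (dotprod m m / 6) => [|s /andP[s0 s1]]; first exact: divr_gt0.
have E : p + s *: m - p = s *: m by rewrite addrAC subrr add0r.
have ss : s ^+ 2 <= s by rewrite expr2 ler_piMr// ltW.
have hin : dotprod (p + s *: m - p) (p + s *: m - p) <=
    2 * dotprod (p + s *: m - p) m.
  rewrite E !dotprodZl dotprodZr; set q := dotprod m m in mm *.
  rewrite mulrA mulrA ler_pM2r// -expr2; lra.
split.
  apply: hball hin; rewrite -subr_eq0 E scaler_eq0 negb_or m0 andbT gt_eqF//.
rewrite lerN2 ler_wsqrtr// lerNr.
apply: le_trans (interior_ball_barrier oO bO us clp nOp hball hin) _.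
rewrite /barrier E !dotprodZl dotprodZr; set q := dotprod m m in mm *.
have : 0 <= (s - s ^+ 2) * q by rewrite mulr_ge0 ?subr_ge0// ltW.
lra.
Qed.

(** A Taylor bound that is uniform in the direction of h, unlike [C2_jet2]. *)
Lemma C2_upper n (A : set 'rV[R]_n.+1) (f : 'rV[R]_n.+1 -> R) x :
  open A -> class_C 2 A f -> A x ->
  exists2 M : R, 0 < M & exists2 d : R, 0 < d & forall h, `|h| < d ->
    f (x + h) <= f x + dirder f x h + M * `|h| ^+ 2.
Proof.
move=> oA fC Ax; have [d0 d00 hA] := open_eps oA Ax.
have [d1 d10 h1] : exists2 d : R, 0 < d & forall h, `|h| < d -> forall i,
    `|partial i f (x + h) - partial i f x - dirder (partial i f) x h| <= 1 * `|h|.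
  by apply: finite_eps => i; exact: C1_expand oA (class_C_S i fC) Ax _ ltr01.
pose C := \sum_i \sum_j `|partial j (partial i f) x| + 1.
have C0 : 0 < C.
  by rewrite ltr_wpDl// sumr_ge0// => i _; rewrite sumr_ge0.
exists (n.+1%:R * C); first exact: mulr_gt0.
exists (Num.min d0 d1); first by rewrite lt_min d00.
move=> h; rewrite lt_min => /andP[hh0 hh1].
have seg c : 0 <= c <= 1 -> `|c *: h| <= `|h|.
  by move=> /andP[c0 c1]; rewrite normrZ ger0_norm// ler_piMl.
have [c hc|c hc] := @mvt01 R (fun c => f (x + c *: h)) (fun c => dirder f (x + c *: h) h).
  apply: C1_is_derive oA (class_CW fC) _; apply: hA.
  exact: le_lt_trans (seg c hc) hh0.
rewrite scale1r scale0r addr0 => E.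
rewrite -[leLHS](subrK (f x)) E [leLHS]addrC -addrA lerD2l -lerBlDl.
rewrite /dirder -sumrB.
have -> : n.+1%:R * C * `|h| ^+ 2 = \sum_(i < n.+1) `|h| * (C * `|h|).
  by rewrite sumr_const card_ord -mulr_natl; ring.
apply: ler_sum => i _; rewrite -mulrBr; apply: le_trans (ler_norm _) _.
rewrite normrM ler_pM// ?entry_le_norm//.
have := h1 _ (le_lt_trans (seg c hc) hh1) i.
set X := partial i f _ - _; set Y := dirder _ _ _ => hXY.
have -> : X = (X - Y) + Y by rewrite subrK.
apply: le_trans (ler_normD _ _) _.
have h2 : `|Y| <= (\sum_j `|partial j (partial i f) x|) * `|h|.
  rewrite /Y /dirder; apply: le_trans (ler_norm_sum _ _ _) _.
  rewrite mulr_suml; apply: ler_sum => j _; rewrite normrM mulrC ler_wpM2l//.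
  apply: le_trans (entry_le_norm _ _) _; exact: seg.
have h3 : \sum_j `|partial j (partial i f) x| <=
    \sum_i0 \sum_j `|partial j (partial i0 f) x|.
  rewrite [leRHS](bigD1 i)//= lerDl; apply: sumr_ge0 => k _; exact: sumr_ge0.
apply: le_trans (lerD hXY h2) _; rewrite /C mulrDl [leRHS]addrC lerD//.
  by rewrite !mul1r seg.
by rewrite ler_wpM2r.
Qed.

Lemma dotprod_row_mx n1 n2 (a c : 'rV[R]_n1) (b d : 'rV[R]_n2) :
  dotprod (row_mx a b) (row_mx c d) = dotprod a c + dotprod b d.
Proof. by rewrite !dotprodE tr_row_mx mul_row_col mxE. Qed.

(** In the chart the boundary lies below a paraboloid of opening M touching at p.
    With m a multiple q of the upward normal (- grad g, 1), the ball
    |z|^2 <= 2 z.m lies above this paraboloid as soon as q M is small, and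
    inside the chart as soon as q is small. *)
Lemma C2_plus_interior_ball Om p : C2_plus Om -> boundary Om p ->
  exists2 m, m != 0 & forall x, x != p ->
    dotprod (x - p) (x - p) <= 2 * dotprod (x - p) m -> Om x.
Proof.
move=> [_ oO _ _ chart] bp; have [Q [g [s [QQ gC hnear hp _]]]] := chart p bp.
have [M M0 [d1 d10 hg]] := C2_upper openT gC (I : setT s).
have [d0 d00 hO] := nbhs_eps hnear.
have QQ' : Q^T *m Q = 1%:M by apply: mulmx1C.
pose m0 : 'rV[R]_(2 + 1) := row_mx (\row_i (- partial i g s)) 1%:M.
have m0n : m0 != 0.
  apply/eqP => /rowP /(_ (rshift 2 0)); rewrite row_mxEr !mxE/= => /eqP.
  by rewrite oner_eq0.
have m0p : 0 < `|m0| by rewrite normr_gt0.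
pose q := Num.min (4 * M)^-1 (Num.min d0 d1 / (12 * `|m0|)).
have q0 : 0 < q.
  by rewrite lt_min invr_gt0 mulr_gt0//= divr_gt0 ?mulr_gt0// lt_min d00.
exists (q *: (m0 *m Q)).
  rewrite scaler_eq0 negb_or gt_eqF//=; apply: contra m0n => /eqP e.
  by rewrite -[m0]mulmx1 -QQ mulmxA e mul0mx.
move=> x xp; pose z : 'rV[R]_(2 + 1) := (x - p) *m Q^T.
have zE : x - p = z *m Q by rewrite /z -mulmxA QQ' mulmx1.
have -> : dotprod (x - p) (x - p) = dotprod z z.
  by rewrite !dotprodE zE trmx_mul mulmxA -(mulmxA z) QQ mulmx1.
have -> : dotprod (x - p) (q *: (m0 *m Q)) = q * dotprod z m0.
  by rewrite dotprodZr !dotprodE /z trmx_mul mulmxA.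
move=> hz.
have zn : z != 0.
  by apply: contra xp => /eqP z0; rewrite -subr_eq0 zE z0 mul0mx.
have zp : 0 < `|z| by rewrite normr_gt0.
have hz2 : `|z| <= 6 * q * `|m0|.
  rewrite -(ler_pM2l zp) -expr2; apply: le_trans (norm_sqr_le_dotprod _) _.
  apply: le_trans hz _; have := dotprod_le_norm z m0; rewrite -(ler_pM2l q0); lra.
have qd : 12 * q * `|m0| <= Num.min d0 d1.
  rewrite mulrAC -[_ * q]mulrC -ler_pdivlMr ?mulr_gt0// /q.
  by rewrite ge_min lexx orbT.
have qm0 : 0 < q * `|m0| by rewrite mulr_gt0.
have h6 : 6 * q * `|m0| < Num.min d0 d1 by lra.
have zlt : `|z| < Num.min d0 d1 := le_lt_trans hz2 h6.
have xlt : `|x - p| < Num.min d0 d1.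
  have xpp : 0 <= `|x - p| by [].
  have : `|x - p| ^+ 2 <= (6 * q * `|m0|) ^+ 2.
    apply: le_trans (norm_sqr_le_dotprod _) _.
    have -> : dotprod (x - p) (x - p) = dotprod z z.
      by rewrite !dotprodE zE trmx_mul mulmxA -(mulmxA z) QQ mulmx1.
    apply: le_trans hz _; have := dotprod_le_norm z m0; rewrite -(ler_pM2l q0) => h1.
    have h2 : q * `|m0| * `|z| <= q * `|m0| * (6 * q * `|m0|).
      by rewrite ler_wpM2l// mulr_ge0// ltW.
    lra.
  have r0 : 0 <= 6 * q * `|m0| by rewrite -mulrA mulr_ge0// ltW.
  rewrite ler_pXn2r ?nnegrE// => h.
  exact: le_lt_trans h h6.
move: zlt xlt; rewrite !lt_min => /andP[_ z1] /andP[x0 _].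
have := hO _ x0; rewrite subrKC => ->; rewrite /above_graph /=.
pose h := lsubmx z; pose k := rsubmx z.
have zhk : z = row_mx h k by rewrite hsubmxK.
have xQ : x *m Q^T = row_mx (s + h) ((g s)%:M + k).
  rewrite -[x](subrK p) mulmxDl -/z -hp /graph_param -mulmxA QQ mulmx1 zhk.
  by rewrite addrC; exact: (@add_row_mx R 1 2 1 s (g s)%:M h k).
have gk : ((g s)%:M + k) 0 0 = g s + k 0 0.
  by move: k {zhk xQ} => k; rewrite !mxE eqxx mulr1n.
rewrite xQ row_mxKl row_mxKr gk.
have hk : `|h| <= `|z|.
  by apply: norm_le_entries => // i; rewrite /h mxE entry_le_norm.
have zm : dotprod z m0 = k 0 0 - dirder g s h.
  rewrite zhk dotprod_row_mx addrC; congr (_ + _).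
    by rewrite dotprodE trmx1 mulmx1.
  rewrite /dotprod /dirder -sumrN; apply: eq_bigr => i _.
  by move: (h 0 i) => r; rewrite mxE mulrN.
have zz : `|h| ^+ 2 <= dotprod z z.
  by apply: le_trans (norm_sqr_le_dotprod _); rewrite lerXn2r ?nnegrE.
have zz0 := dotprod_gt0 zn.
apply: le_lt_trans (hg h (le_lt_trans hk z1)) _.
rewrite zm in hz.
have qM : q * (4 * M) <= 1.
  by rewrite -ler_pdivlMr ?mulr_gt0// mul1r ge_min lexx.
have w0 : 0 < k 0 0 - dirder g s h.
  by rewrite -(pmulr_rgt0 _ q0); lra.
have e1 : q * (4 * M) * (k 0 0 - dirder g s h) <= k 0 0 - dirder g s h.
  by rewrite ler_piMl// ltW.
have e2 : M * `|h| ^+ 2 <= M * dotprod z z by rewrite ler_wpM2l// ltW.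
have e3 : M * dotprod z z <= M * (2 * (q * (k 0 0 - dirder g s h))).
  by rewrite ler_wpM2l// ltW.
have {e1 e2 e3} e4 : M * `|h| ^+ 2 <= (k 0 0 - dirder g s h) / 2.
  apply: le_trans e2 (le_trans e3 _); move: (k 0 0 - _) e1 => w e1; lra.
rewrite -addrA ltrD2l addrC -ltrBrDr; apply: le_lt_trans e4 _.
by rewrite ltr_pdivrMr// mulr_natr mulr2n ltrDl.
Qed.

(** From u = - v^2 one gets D^2 u = 2 (a D^2 v - th^T th) with a = - v. *)
Lemma root_jet Om u x : open Om -> admissible_solution Om u -> Om x -> u x < 0 ->
  let a := Num.sqrt (- u x) in
  exists (th : 'rV[R]_3) (A : 'M[R]_3),
   [/\ A^T = A, sigma2 (a *: A - th^T *m th) = 4^-1,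
       0 < \tr (a *: A - th^T *m th) &
       forall xi, jet2 (fun s => - Num.sqrt (- u (x + s *: xi)))
         (dotprod xi th) (qform A xi / 2)].
Proof.
move=> oO us Ox ux a; have [Hs Hs2 Ht] := trace_hessian oO us Ox.
have [[uC _] _ _ _] := us.
have a0 : 0 < a by rewrite sqrtr_gt0 oppr_gt0.
pose th : 'rV[R]_3 := \row_i (partial i u x / (2 * a)).
have thE xi : dotprod xi th = dirder u x xi / (2 * a).
  by rewrite /dotprod /dirder mulr_suml; apply: eq_bigr => i _; rewrite mxE mulrA.
pose A := a^-1 *: (2^-1 *: hessian u x + th^T *m th).
have AE : a *: A - th^T *m th = 2^-1 *: hessian u x.
  by rewrite /A scalerA divff ?gt_eqF// scale1r addrK.
exists th, A; split.
- by rewrite /A linearZ/= linearD/= linearZ/= Hs trmx_mul trmxK.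
- by rewrite AE sigma2Z Hs2; field.
- by rewrite AE mxtraceZ mulr_gt0//; lra.
move=> xi; have := @jet2_sqrt R _ _ _ (C2_jet2 xi oO uC Ox).
rewrite scale0r addr0 -/a => /(_ ux) J; apply: (jet2_eq J); first by rewrite thE.
rewrite -thE /A qformZ qformD qformZ.
have -> : qform (th^T *m th) xi = dotprod xi th ^+ 2.
  rewrite /qform mulmxA -mulmxA mxE big_ord1 expr2 -!dotprodE.
  by rewrite [dotprod th xi]dotprodC.
move: (qform _ _) (dotprod _ _) => X Y; field; rewrite gt_eqF//.
Qed.

End BoundaryBehaviour.

(** * Convex combinations, Minkowski combinations, extreme weights *)

Section Convexity.
Variable R : realType.
Variable n : nat.
Notation V := 'rV[R]_n.
Implicit Types (A B : set V) (x y z : V).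

Lemma convex_comb2 A x y (k : R) : convex_set A -> 0 <= k <= 1 -> A x -> A y ->
  A (k *: x + (1 - k) *: y).
Proof.
move=> cA /andP[k0 k1] Ax Ay.
by have := cA x y (Itv01 k0 k1) (mem_set Ax) (mem_set Ay); rewrite inE.
Qed.

Lemma convex_setP A :
  (forall x y (k : R), 0 <= k <= 1 -> A x -> A y -> A (k *: x + (1 - k) *: y)) ->
  convex_set A.
Proof.
move=> h x y k; rewrite !inE => Ax Ay.
by apply: (h x y k%:num) => //; apply/andP; split.
Qed.

Lemma convex_comb A (I : finType) (l : I -> R) (z : I -> V) : convex_set A ->
  (forall i, 0 <= l i) -> \sum_i l i = 1 -> (forall i, A (z i)) ->
  A (\sum_i l i *: z i).
Proof.
move=> cA l0 l1 Az.
suff H (r : seq I) : 0 < \sum_(i <- r) l i ->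
    A ((\sum_(i <- r) l i)^-1 *: \sum_(i <- r) l i *: z i).
  by have := H (index_enum I); rewrite l1 invr1 scale1r; apply.
elim: r => [|i r IH]; first by rewrite big_nil ltxx.
rewrite !big_cons; set S := \sum_(j <- r) l j; set Z := \sum_(j <- r) _.
move=> lS; have S0 : 0 <= S by exact: sumr_ge0.
have [Sp|Sn] := ltrP 0 S; last first.
  have Se : S = 0 by apply/eqP; rewrite eq_le Sn.
  have -> : Z = 0.
    have /eqP := Se; rewrite psumr_eq0// => /allP S'.
    rewrite /Z big_seq big1// => j /S'/eqP ->; exact: scale0r.
  rewrite Se !addr0 in lS *.
  by rewrite scalerA mulVf ?gt_eqF// scale1r.
have -> : (l i + S)^-1 *: (l i *: z i + Z) =
   (l i / (l i + S)) *: z i + (1 - l i / (l i + S)) *: (S^-1 *: Z).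
  rewrite scalerDr !scalerA mulrC; congr (_ + _ *: _).
  by field; rewrite !gt_eqF.
apply: convex_comb2 => //; last exact: IH.
by rewrite divr_ge0 ?l0 ?(ltW lS)//= ler_pdivrMr// mul1r lerDl.
Qed.

Lemma closure_eps A z : closure A z <->
  forall e : R, 0 < e -> exists2 y, A y & `|y - z| < e.
Proof.
split=> [cz e e0|h B nB].
  have [y [Ay By]] := cz _ (nbhsx_ballx z e e0).
  exists y => //; by move: By; rewrite -ball_normE /ball_/= distrC.
have [d d0 hd] := nbhs_eps nB; have [y Ay yz] := h d d0.
by exists y; split => //; rewrite -(subrK z y) addrC; exact: hd.
Qed.

Lemma convex_comb_closure A (I : finType) (l : I -> R) (z : I -> V) :
  convex_set A -> (forall i, 0 <= l i) -> \sum_i l i = 1 ->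
  (forall i, closure A (z i)) -> closure A (\sum_i l i *: z i).
Proof.
move=> cA l0 l1 Az; apply/closure_eps => e e0.
have e2 : 0 < e / 2 by rewrite divr_gt0.
have hex i : exists y, A y /\ `|y - z i| < e / 2.
  by have [y ? ?] := (closure_eps A (z i)).1 (Az i) _ e2; exists y.
have [y hy] := boolp.choice hex.
exists (\sum_i l i *: y i).
  by apply: convex_comb => // i; have [] := hy i.
rewrite -sumrB; apply: le_lt_trans (ler_norm_sum _ _ _) _.
apply: (@le_lt_trans _ _ (\sum_i l i * (e / 2))); last first.
  by rewrite -mulr_suml l1 mul1r; lra.
apply: ler_sum => i _; rewrite -scalerBr normrZ ger0_norm// ler_wpM2l//.
by rewrite ltW//; have [] := hy i.
Qed.

(** Replace the points other than z i0 by nearby points of A, and correct z i0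
    within A by the small error that this makes. *)
Lemma convex_comb_interior A (I : finType) (l : I -> R) (z : I -> V) i0 :
  open A -> convex_set A -> (forall i, 0 <= l i) -> \sum_i l i = 1 ->
  (forall i, closure A (z i)) -> 0 < l i0 -> A (z i0) ->
  A (\sum_i l i *: z i).
Proof.
move=> oA cA l0 l1 Az li0 Azi0; have [d d0 hd] := open_eps oA Azi0.
have e0 : 0 < l i0 * d / 2 by rewrite divr_gt0// mulr_gt0.
have hex i : exists y, A y /\ `|y - z i| < l i0 * d / 2.
  by have [y ? ?] := (closure_eps A (z i)).1 (Az i) _ e0; exists y.
have [y hy] := boolp.choice hex.
pose D := \sum_(i | i != i0) l i *: (z i - y i).
pose y' i := if i == i0 then z i0 + (l i0)^-1 *: D else y i.
have -> : \sum_i l i *: z i = \sum_i l i *: y' i.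
  rewrite (bigD1 i0)//= [RHS](bigD1 i0)//= /y' eqxx scalerDr scalerA.
  rewrite divff ?gt_eqF// scale1r -addrA; congr (_ + _).
  rewrite -[RHS]/(D + _) /D -big_split/=; apply: eq_bigr => i /negbTE ->.
  by rewrite -scalerDr subrK.
apply: convex_comb => // i; rewrite /y'; case: eqP => _; last by have [] := hy i.
apply: hd; rewrite normrZ normfV gtr0_norm// ltr_pdivrMl//.
apply: le_lt_trans (ler_norm_sum _ _ _) _.
apply: (@le_lt_trans _ _ (\sum_i l i * (l i0 * d / 2))); last first.
  rewrite -mulr_suml l1 mul1r ltr_pdivrMr// mulr_natr mulr2n ltrDl.
  exact: mulr_gt0.
rewrite [leRHS](bigD1 i0)//= -[leLHS]add0r lerD//.
  by rewrite mulr_ge0// ltW.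
apply: ler_sum => j _; rewrite normrZ ger0_norm// ler_wpM2l// distrC ltW//.
by have [] := hy j.
Qed.

(** The m vectors (z i, 1) live in a space of dimension n + 1. *)
Lemma affine_dependence m (z : 'I_m -> V) : (n.+1 < m)%N ->
  exists c : 'I_m -> R, [/\ exists i, c i != 0, \sum_i c i = 0 &
    \sum_i c i *: z i = 0].
Proof.
move=> nm; pose M : 'M[R]_(m, n + 1) := row_mx (\matrix_i z i) (const_mx 1).
have : kermx M != 0.
  rewrite -mxrank_eq0 mxrank_ker -lt0n subn_gt0.
  by apply: leq_ltn_trans (rank_leq_col M) _; rewrite addn1.
move=> /rowV0Pn[c /sub_kermxP cM cn]; exists (fun i => c 0 i).
have : c *m M = 0 by [].
rewrite mul_mx_row => /eqP; rewrite row_mx_eq0 => /andP[/eqP c1 /eqP c2]; split.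
- apply/existsP; apply: contraR cn; rewrite negb_exists => /forallP h.
  by apply/eqP/rowP => i; rewrite mxE; apply/eqP; have := h i; rewrite negbK.
- have := congr1 (fun N : 'M[R]_(1, 1) => N 0 0) c2.
  rewrite mxE [RHS]mxE => E; rewrite -[RHS]E.
  by apply: eq_bigr => i _; rewrite mxE mulr1.
- rewrite -[RHS]c1 mulmx_sum_row; apply: eq_bigr => i _.
  by rewrite rowK.
Qed.

(** Move the weights along an affine dependence, in the direction that does not
    increase the mean of v, until one of them vanishes. *)
Lemma caratheodory m (l v : 'I_m -> R) (z : 'I_m -> V) : (n.+1 < m)%N ->
  (forall i, 0 <= l i) ->
  exists l' : 'I_m -> R, [/\ forall i, 0 <= l' i, exists k, l' k = 0,
    \sum_i l' i = \sum_i l i, \sum_i l' i *: z i = \sum_i l i *: z i &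
    \sum_i l' i * v i <= \sum_i l i * v i].
Proof.
move=> nm l0; have [c0 [[i0 ci0] c0s c0z]] := affine_dependence z nm.
have [c [[i1 ci1] cs cz cv]] : exists c : 'I_m -> R, [/\ exists i, c i != 0,
    \sum_i c i = 0, \sum_i c i *: z i = 0 & 0 <= \sum_i c i * v i].
  have [h|h] := lerP 0 (\sum_i c0 i * v i); first by exists c0; split => //; exists i0.
  exists (fun i => - c0 i); split.
  - by exists i0; rewrite oppr_eq0.
  - by rewrite sumrN c0s oppr0.
  - by under eq_bigr do rewrite scaleNr; rewrite sumrN c0z oppr0.
  - by under eq_bigr do rewrite mulNr; rewrite sumrN oppr_ge0 ltW.
have [i2 ci2] : exists i, 0 < c i.
  apply/existsP; apply: contraT; rewrite negb_exists => /forallP h.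
  have h' i : 0 <= - c i by rewrite oppr_ge0 leNgt.
  have /eqP : \sum_i - c i = 0 by rewrite sumrN cs oppr0.
  rewrite psumr_eq0// => /allP /(_ i1); rewrite mem_index_enum => /(_ isT).
  by rewrite /= oppr_eq0 (negbTE ci1).
have [k ck hk] := @arg_minP _ R _ i2 (fun i => 0 < c i) (fun i => l i / c i) ci2.
pose s := l k / c k; have s0 : 0 <= s by rewrite divr_ge0// ltW.
exists (fun i => l i - s * c i); split.
- move=> i; rewrite subr_ge0; have [cp|cn] := ltrP 0 (c i).
    by rewrite -ler_pdivlMr//; exact: hk.
  by apply: le_trans (l0 i); rewrite mulr_ge0_le0.
- by exists k; rewrite /s divfK ?subrr// gt_eqF.
- by rewrite sumrB -mulr_sumr cs mulr0 subr0.
- under eq_bigr do rewrite scalerBl -scalerA.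
  by rewrite sumrB -scaler_sumr cz scaler0 subr0.
- under eq_bigr do rewrite mulrBl -mulrA.
  by rewrite sumrB -mulr_sumr lerBlDr lerDl mulr_ge0.
Qed.

End Convexity.

Section Minkowski.
Variable R : realType.
Variables (t : R) (A B : set 'rV[R]_3).
Hypothesis t01 : 0 < t < 1.
Let T := minkowski_comb t A B.

Let t0 : 0 < t. Proof. by case/andP: t01. Qed.
Let t1 : 0 < 1 - t. Proof. by case/andP: t01 => _; rewrite subr_gt0. Qed.

Lemma minkowski_mem x y : A x -> B y -> T ((1 - t) *: x + t *: y).
Proof. by move=> Ax By; exists x => //; exists y. Qed.

Lemma minkowski_open : open A -> open T.
Proof.
move=> oA; rewrite openE => _ [x Ax [y By <-]].
have [d d0 hd] := open_eps oA Ax.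
apply/nbhs_ballP; exists ((1 - t) * d); first exact: mulr_gt0.
move=> z; rewrite -ball_normE /ball_/= => hz.
pose w := (1 - t) *: x + t *: y - z.
exists (x - (1 - t)^-1 *: w).
  apply: hd; rewrite normrN normrZ normfV (gtr0_norm t1) ltr_pdivrMl//.
exists y => //; rewrite scalerBr scalerA divff ?gt_eqF// scale1r.
by rewrite addrAC subKr.
Qed.

Lemma minkowski_convex : convex_set A -> convex_set B -> convex_set T.
Proof.
move=> cA cB; apply: convex_setP => _ _ k hk [x Ax [y By <-]] [x' Ax' [y' By' <-]].
exists (k *: x + (1 - k) *: x'); first exact: convex_comb2.
exists (k *: y + (1 - k) *: y'); first exact: convex_comb2.
by apply/rowP => i; rewrite !mxE; ring.
Qed.

Lemma minkowski_bounded : bounded_set A -> bounded_set B -> bounded_set T.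
Proof.
move=> /bounded_by[M hM] /bounded_by[N hN].
apply: (@bounded_by_set _ _ _ ((1 - t) * M + t * N)) => _ [x Ax [y By <-]].
apply: le_trans (ler_normD _ _) _.
by rewrite !normrZ (gtr0_norm t0) (gtr0_norm t1) lerD// ler_wpM2l ?hM ?hN// ltW.
Qed.

Lemma minkowski_closure x y : closure A x -> closure B y ->
  closure T ((1 - t) *: x + t *: y).
Proof.
move=> /closure_eps cx /closure_eps cy; apply/closure_eps => e e0.
have [x' Ax hx] := cx e e0; have [y' By hy] := cy e e0.
exists ((1 - t) *: x' + t *: y'); first exact: minkowski_mem.
have -> : (1 - t) *: x' + t *: y' - ((1 - t) *: x + t *: y) =
   (1 - t) *: (x' - x) + t *: (y' - y) by apply/rowP => i; rewrite !mxE; ring.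
apply: le_lt_trans (ler_normD _ _) _.
rewrite !normrZ (gtr0_norm t0) (gtr0_norm t1).
have e1 : (1 - t) * `|x' - x| < (1 - t) * e by rewrite ltr_pM2l.
have e2 : t * `|y' - y| < t * e by rewrite ltr_pM2l.
by apply: lt_le_trans (ltrD e1 e2) _; rewrite -mulrDl subrK mul1r.
Qed.

Lemma minkowski_interior_l x y : open A -> A x -> closure B y ->
  T ((1 - t) *: x + t *: y).
Proof.
move=> oA Ax /closure_eps cy; have [d d0 hd] := open_eps oA Ax.
have [y' By hy] := cy ((1 - t) * d / t) (divr_gt0 (mulr_gt0 t1 d0) t0).
exists (x + ((1 - t)^-1 * t) *: (y - y')); last first.
  exists y' => //; apply/rowP => i; rewrite !mxE; field; rewrite gt_eqF//.
apply: hd; rewrite normrZ normrM normfV (gtr0_norm t0) (gtr0_norm t1) distrC.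
by rewrite -mulrA ltr_pdivrMl// mulrC -ltr_pdivlMr.
Qed.

Lemma minkowski_interior_r x y : open B -> closure A x -> B y ->
  T ((1 - t) *: x + t *: y).
Proof.
move=> oB /closure_eps cx By; have [d d0 hd] := open_eps oB By.
have [x' Ax hx] := cx (t * d / (1 - t)) (divr_gt0 (mulr_gt0 t0 d0) t1).
exists x' => //; exists (y + (t^-1 * (1 - t)) *: (x - x')).
  apply: hd; rewrite normrZ normrM normfV (gtr0_norm t0) (gtr0_norm t1) distrC.
  by rewrite -mulrA ltr_pdivrMl// mulrC -ltr_pdivlMr.
by apply/rowP => i; rewrite !mxE; field; rewrite gt_eqF.
Qed.

End Minkowski.

(** * Maximal weighted configurations *)

Section Configurations.
Variable R : realType.
Notation V := 'rV[R]_3.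

Definition barycentre m (w : bool -> R) (l : 'I_m -> R) (P : 'I_m -> bool -> V) : V :=
  \sum_i l i *: \sum_b w b *: P i b.

Definition mean_value m (w : bool -> R) (v : bool -> V -> R) (l : 'I_m -> R)
    (P : 'I_m -> bool -> V) : R :=
  \sum_i l i * \sum_b w b * v b (P i b).

Definition configuration m (Om : bool -> set V) (l : 'I_m -> R) (P : 'I_m -> bool -> V) :=
  [/\ forall i, 0 <= l i, \sum_i l i = 1 & forall i b, closure (Om b) (P i b)].

Lemma mx_coord_continuous (T : topologicalType) m n i j :
  continuous (fun M : 'M[T]_(m, n) => M i j).
Proof.
move=> M P nP.
exists (fun i' j' => if (i' == i) && (j' == j) then P else setT).
  by move=> i' j'; case: ifP => [/andP[/eqP-> /eqP->]//|_]; exact: filterT.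
by move=> N /(_ i j); rewrite !eqxx.
Qed.

(** The configurations are encoded in the compact product of copies of V: each
    index has three slots, the first one carrying the weight (as the coordinate 0
    of a vector with all coordinates in [0, 1]) and the others the two points. *)
Lemma exists_max_gap m (w : bool -> R) (Om : bool -> set V) (D : set V)
    (v : bool -> V -> R) (vt : V -> R) :
  (forall b, bounded_set (Om b)) ->
  (forall b, {within closure (Om b), continuous (v b)}) ->
  {within D, continuous vt} ->
  (forall (l : 'I_m -> R) P, configuration Om l P -> D (barycentre w l P)) ->
  (exists (l : 'I_m -> R) P, configuration Om l P) ->
  exists (l : 'I_m -> R) P, configuration Om l P /\
    forall (l' : 'I_m -> R) P', configuration Om l' P' ->
      vt (barycentre w l' P') - mean_value w v l' P' <=
      vt (barycentre w l P) - mean_value w v l P.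
Proof.
move=> bO cv cvt hD [l0 [P0 c0]].
pose cfg := 'rV['rV[V]_3]_m.
pose slot (b : bool) : 'I_3 := if b then 2 else 1.
pose lf (c : cfg) i : R := c 0 i 0 0 0 0.
pose Pf (c : cfg) i (b : bool) : V := c 0 i 0 (slot b).
pose mk (l : 'I_m -> R) (P : 'I_m -> bool -> V) : cfg :=
  \row_i \row_j (if j == 0 then const_mx (l i) else P i (j == 2)).
have lmk l P : lf (mk l P) = l by apply/funext => i; rewrite /lf !mxE.
have Pmk l P : Pf (mk l P) = P.
  by apply/funext => i; apply/funext => b; rewrite /Pf !mxE; case: b.
have cc i j : continuous (fun c : cfg => c 0 i 0 j).
  move=> c; apply: (@cvg_comp _ _ _ (fun c : cfg => c 0 i) (fun d : 'rV[V]_3 => d 0 j)).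
    exact: mx_coord_continuous.
  exact: mx_coord_continuous.
have cl i : continuous (fun c : cfg => lf c i).
  move=> c; apply: (@cvg_comp _ _ _ (fun c : cfg => c 0 i 0 0) (fun x : V => x 0 0)).
    exact: cc.
  exact: mx_coord_continuous.
have cP i b : continuous (fun c : cfg => Pf c i b) by exact: cc.
have ci i : continuous (fun c => \sum_b w b *: Pf c i b).
  by apply: continuous_sum => b c; exact: (cvgZ (cvg_cst (w b)) (cP i b c)).
have cz : continuous (fun c => barycentre w (lf c) (Pf c)).
  rewrite /barycentre; apply: continuous_sum => i c.
  exact: (cvgZ (cl i c) (ci i c)).
pose S (j : 'I_3) : set V :=
  if j == 0 then [set x : V | forall k, `[0, 1]%classic (x 0 k)]
  else closure (Om (j == 2)).
pose K1 := [set c : cfg | forall i, [set d : 'rV[V]_3 | forall j, S j (d 0 j)] (c 0 i)].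
pose K := K1 `&` [set c | \sum_i lf c i = 1].
have Kc : compact K.
  apply: compact_closedI.
    apply: (@rV_compact _ _ (fun=> [set d : 'rV[V]_3 | forall j, S j (d 0 j)])) => i.
    apply: (@rV_compact _ _ S) => j; rewrite /S; case: ifP => _.
      by apply: (@rV_compact R 3 (fun=> `[0 : R, 1 : R]%classic)) => k; exact: segment_compact.
    exact: bounded_compact_closure.
  apply: (@preimage_closed _ _ (fun c => \sum_i lf c i) [set y | y = 1]).
    by move=> c _; apply: continuous_sum; exact: cl.
  exact: closed_eq.
have KP c : K c -> configuration Om (lf c) (Pf c).
  move=> [h1 h2]; split => //.
  - by move=> i; have := h1 i 0 0; rewrite /= in_itv/= => /andP[].
  - by move=> i b; have := h1 i (slot b); case: b.
have Kmk l P : configuration Om l P -> K (mk l P).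
  move=> [l0' l1 lP]; split; last by rewrite /= lmk.
  move=> i j /=; rewrite !mxE /S; case: eqP => // _ k /=.
  rewrite mxE in_itv/= l0'/= -l1 (bigD1 i)//= lerDl; exact: sumr_ge0.
have cf : {within K, continuous
    (fun c => vt (barycentre w (lf c) (Pf c)) - mean_value w v (lf c) (Pf c))}.
  have c1 := within_comp cvt cz (fun c Kc' => hD _ _ (KP c Kc')).
  have c2 i b : {within K, continuous (fun c => v b (Pf c i b))}.
    by apply: (within_comp (cv b) (cP i b)) => c /KP[_ _ h]; exact: h.
  apply/subspace_continuousP => c Kc'; apply: cvgB.
    by move/subspace_continuousP: c1; exact.
  apply: (@cvg_big _ _ +%R 0 xpredT) => [|i _]; first exact: add_continuous.
  apply: cvgM; first by apply: cvg_within_filter; exact: cl.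
  apply: (@cvg_big _ _ +%R 0 xpredT) => [|b _]; first exact: add_continuous.
  apply: cvgM; first exact: cvg_cst.
  by move/subspace_continuousP: (c2 i b); exact.
have K0 : K !=set0 by exists (mk l0 P0); exact: Kmk.
have [c /set_mem Kc' hc] := compact_EVT_max K0 Kc cf.
exists (lf c), (Pf c); split; first exact: KP.
by move=> l P /Kmk/mem_set/hc; rewrite lmk Pmk.
Qed.

End Configurations.

Section Roots.
Variable R : realType.
Notation V := 'rV[R]_3.

(** The equation for v = - sqrt (- u), with gradient th and Hessian A at x. *)
Definition root_jets (v : V -> R) x (th : V) (A : 'M[R]_3) :=
  [/\ A^T = A, sigma2 (- v x *: A - th^T *m th) = 4^-1,
      0 < \tr (- v x *: A - th^T *m th) &
      forall xi, jet2 (fun s => v (x + s *: xi)) (dotprod xi th) (qform A xi / 2)].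

Definition root_solution (Om : set V) (v : V -> R) :=
  [/\ {within closure Om, continuous v},
      forall x, Om x -> v x < 0,
      forall x, closure Om x -> ~ Om x -> v x = 0 &
      forall x, Om x -> exists th A, root_jets v x th A].

(** Infinite slope at the boundary, along some direction entering the domain. *)
Definition steep (Om : set V) (v : V -> R) := forall p, closure Om p -> ~ Om p ->
  exists m : V, exists2 k : R, 0 < k &
    forall s, 0 < s <= 1 -> Om (p + s *: m) /\ v (p + s *: m) <= - Num.sqrt (k * s).

Lemma admissible_root_solution Om u : open Om -> bounded_set Om ->
  admissible_solution Om u -> root_solution Om (fun x => - Num.sqrt (- u x)).
Proof.
move=> oO bO us; have [_ cu _ ub] := us; have u0 := solution_lt0 oO bO us.
split.
- apply/subspace_continuousP => x clx; apply: cvgN.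
  apply: (@cvg_comp _ _ _ (fun y => - u y) Num.sqrt); last exact: sqrt_continuous.
  by apply: cvgN; move/subspace_continuousP: cu; exact.
- by move=> x /u0 ux; rewrite oppr_lt0 sqrtr_gt0 oppr_gt0.
- move=> x clx nOx; rewrite ub ?oppr0 ?sqrtr0 ?oppr0//.
  exact/open_boundary.
- move=> x Ox; have [th [A [h1 h2 h3 h4]]] := root_jet oO us Ox (u0 x Ox).
  by exists th, A; split; rewrite ?opprK.
Qed.

Lemma C2_plus_steep Om u : C2_plus Om -> admissible_solution Om u ->
  steep Om (fun x => - Num.sqrt (- u x)).
Proof.
move=> C us p clp nOp; have [_ oO _ bO _] := C.
have bp : boundary Om p by apply/open_boundary.
have [m m0 hm] := C2_plus_interior_ball C bp.
by exists m; exact: (root_steep oO bO us clp nOp m0 hm).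
Qed.

End Roots.

Section MaxPoint.
Variable R : realType.
Notation V := 'rV[R]_3.
Variables (n : nat) (w : bool -> R) (Om : bool -> set V) (v : bool -> V -> R).
Variables (T : set V) (vt : V -> R).
Implicit Types (l : 'I_n -> R) (P : 'I_n -> bool -> V).

Hypothesis w0 : forall b, 0 < w b.
Hypothesis oO : forall b, open (Om b).
Hypothesis vO : forall b, root_solution (Om b) (v b).
Hypothesis sO : forall b, steep (Om b) (v b).
Hypothesis vT : root_solution T vt.
Hypothesis oT : open T.
Hypothesis inclosure : forall l P, configuration Om l P ->
  closure T (barycentre w l P).
Hypothesis interior : forall l P i b, configuration Om l P -> 0 < l i ->
  Om b (P i b) -> T (barycentre w l P).

Definition gap l P := vt (barycentre w l P) - mean_value w v l P.

Definition max_gap l P := configuration Om l P /\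
  forall l' P', configuration Om l' P' -> gap l' P' <= gap l P.

Lemma barycentre_pair l P : barycentre w l P =
  \sum_(p : 'I_n * bool) (l p.1 * w p.2) *: P p.1 p.2.
Proof.
rewrite /barycentre -(pair_bigA _ (fun i b => (l i * w b) *: P i b))/=.
by apply: eq_bigr => i _; rewrite scaler_sumr; apply: eq_bigr => b _; rewrite scalerA.
Qed.

Lemma mean_value_pair l P : mean_value w v l P =
  \sum_(p : 'I_n * bool) (l p.1 * w p.2) * v p.2 (P p.1 p.2).
Proof.
rewrite /mean_value -(pair_bigA _ (fun i b => (l i * w b) * v b (P i b)))/=.
by apply: eq_bigr => i _; rewrite mulr_sumr; apply: eq_bigr => b _; rewrite mulrA.
Qed.

Lemma barycentre_shift l P (X : 'I_n -> bool -> V) s :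
  barycentre w l (fun i b => P i b + s *: X i b) =
  barycentre w l P + s *: barycentre w l X.
Proof.
rewrite !barycentre_pair scaler_sumr -big_split/=; apply: eq_bigr => p _.
by rewrite scalerDr !scalerA [s * _]mulrC.
Qed.

Lemma root_solution_eq0 b x : closure (Om b) x -> v b x != 0 -> Om b x.
Proof.
move=> clx vn; have [_ _ zer _] := vO b; apply: contrapT => nO.
by move: vn; rewrite zer ?eqxx.
Qed.

(** The gap exceeds v_t at the barycentre by the weighted sum of the - v, so if
    it is positive, some point of positive weight has v < 0 and is interior,
    because v_t is never positive.  The barycentre is then interior too. *)
Lemma gap_pos_interior l P : configuration Om l P -> 0 < gap l P ->
  T (barycentre w l P).
Proof.
move=> cfg g0; have [l0 l1 lP] := cfg.
have [[p hp]|none] := pselect (exists p : 'I_n * bool,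
    l p.1 * w p.2 * v p.2 (P p.1 p.2) != 0).
  move: hp; rewrite !mulf_eq0 !negb_or => /andP[/andP[lp _] vp].
  apply: (interior cfg (i := p.1) (b := p.2)).
    by rewrite lt_neqAle eq_sym lp l0.
  exact: root_solution_eq0.
move: g0; rewrite /gap mean_value_pair big1 ?subr0; last first.
  by move=> p _; apply/eqP; apply: contrapT => /negP hp; apply: none; exists p.
have [_ neg zer _] := vT.
have [//|nT] := pselect (T (barycentre w l P)).
by rewrite zer ?ltxx//; exact: inclosure.
Qed.

Definition update P i b q : 'I_n -> bool -> V :=
  fun j c => if (j == i) && (c == b) then q else P j c.

Lemma barycentre_update l P i b q : barycentre w l (update P i b q) =
  barycentre w l P + (l i * w b) *: (q - P i b).
Proof.
rewrite !barycentre_pair (bigD1 (i, b))//= [in RHS](bigD1 (i, b))//=.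
rewrite {1}/update !eqxx/= scalerBr [RHS]addrC addrA subrK; congr (_ + _).
apply: eq_bigr => -[j c] /=; rewrite -[(_, _) == _]/((j == i) && (c == b)).
by rewrite /update => /negbTE ->.
Qed.

Lemma mean_value_update l P i b q : mean_value w v l (update P i b q) =
  mean_value w v l P + l i * w b * (v b q - v b (P i b)).
Proof.
rewrite !mean_value_pair (bigD1 (i, b))//= [in RHS](bigD1 (i, b))//=.
rewrite {1}/update !eqxx/= mulrBr [RHS]addrC addrA subrK; congr (_ + _).
apply: eq_bigr => -[j c] /=; rewrite -[(_, _) == _]/((j == i) && (c == b)).
by rewrite /update => /negbTE ->.
Qed.

Lemma configuration_update l P i b q : configuration Om l P ->
  closure (Om b) q -> configuration Om l (update P i b q).
Proof.
move=> [l0 l1 lP] cq; split => // j c; rewrite /update.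
by case: ifP => // /andP[_ /eqP ->].
Qed.

(** Moving a boundary point inwards by s m changes the value of v_t by at most a
    multiple of s, but it decreases v by a multiple of sqrt s. *)
Lemma max_gap_interior l P i b : max_gap l P -> 0 < gap l P -> 0 < l i ->
  Om b (P i b).
Proof.
move=> [cfg hmax] g0 li; have [l0 l1 lP] := cfg.
have Tz := gap_pos_interior cfg g0.
apply: contrapT => nO; set p := P i b in nO.
have [m [k k0 hm]] := sO (lP i b) nO.
have vp : v b p = 0 by have [_ _ zer _] := vO b; exact: (zer p (lP i b) nO).
have [_ _ _ /(_ _ Tz)[th [A [_ _ _ jets]]]] := vT.
have [K K0 [d d0 hd]] := jet2_lipschitz (jets ((l i * w b) *: m)).
pose c := l i * w b; have c0 : 0 < c by rewrite mulr_gt0.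
pose s := Num.min (Num.min 1 (d / 2)) (c ^+ 2 * k / (2 * K ^+ 2)).
have s0 : 0 < s.
  by rewrite !lt_min ltr01/= !divr_gt0// mulr_gt0// exprn_gt0.
have s1 : s <= 1 by rewrite !ge_min lexx.
have sd : s < d.
  by apply: (@le_lt_trans _ _ (d / 2)); [rewrite !ge_min lexx orbT|lra].
have sK : s * (2 * K ^+ 2) <= c ^+ 2 * k.
  by rewrite -ler_pdivlMr ?mulr_gt0 ?exprn_gt0// ge_min lexx orbT.
have s01 : 0 < s <= 1 by rewrite s0 s1.
have [Oq vq] := hm s s01.
have := hmax l _ (configuration_update i cfg (subset_closure Oq)).
rewrite /gap barycentre_update mean_value_update -/p vp subr0.
have -> : p + s *: m - p = s *: m by rewrite addrAC subrr add0r.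
rewrite scalerA mulrC -scalerA -/c.
have := hd s; rewrite gtr0_norm// => /(_ sd); rewrite scale0r addr0 ler_norml.
move=> /andP[h1 _] h2.
have h3 : c * Num.sqrt (k * s) <= K * s.
  have : c * v b (p + s *: m) <= c * - Num.sqrt (k * s) by rewrite ler_pM2l.
  rewrite -/c in h1 h2 *; lra.
have sq : Num.sqrt (k * s) ^+ 2 = k * s by rewrite sqr_sqrtr// mulr_ge0// ltW.
have h4 : c ^+ 2 * (k * s) <= K ^+ 2 * s ^+ 2.
  by rewrite -sq -!exprMn lerXn2r// nnegrE mulr_ge0 ?sqrtr_ge0// ltW.
have h5 : s * (s * (2 * K ^+ 2)) <= s * (c ^+ 2 * k) by rewrite ler_pM2l.
have : 0 < K ^+ 2 * s ^+ 2 by rewrite mulr_gt0// exprn_gt0.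
move: h4 h5; move: (c ^+ 2) (K ^+ 2) => C2 K2; lra.
Qed.

Section SecondVariation.
Variables (l : 'I_n -> R) (P : 'I_n -> bool -> V).
Hypothesis hmax : max_gap l P.
Hypothesis gpos : 0 < gap l P.
Variables (th : 'I_n -> bool -> V) (A : 'I_n -> bool -> 'M[R]_3).
Variables (tht : V) (At : 'M[R]_3).
Hypothesis hA : forall i b, 0 < l i -> root_jets (v b) (P i b) (th i b) (A i b).
Hypothesis hAt : root_jets vt (barycentre w l P) tht At.

Let l0 i : 0 <= l i. Proof. by have [[]] := hmax. Qed.

(** Points of weight 0 may lie on the boundary, so they stay fixed. *)
Lemma max_gap_variation (X : 'I_n -> bool -> V) :
  (forall i b, ~~ (0 < l i) -> X i b = 0) ->
  dotprod (barycentre w l X) tht =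
    \sum_(p : 'I_n * bool) l p.1 * w p.2 * dotprod (X p.1 p.2) (th p.1 p.2) /\
  qform At (barycentre w l X) <=
    \sum_(p : 'I_n * bool) l p.1 * w p.2 * qform (A p.1 p.2) (X p.1 p.2).
Proof.
move=> X0; have [cfg hm] := hmax; have [_ l1 lP] := cfg.
have [_ _ _ jt] := hAt.
pose z := barycentre w l P; pose zX := barycentre w l X.
have J1 := jt zX.
have J2 : jet2 (fun s => \sum_(p : 'I_n * bool) l p.1 * w p.2 *
      v p.2 (P p.1 p.2 + s *: X p.1 p.2))
   (\sum_(p : 'I_n * bool) l p.1 * w p.2 * dotprod (X p.1 p.2) (th p.1 p.2))
   (\sum_(p : 'I_n * bool) l p.1 * w p.2 * (qform (A p.1 p.2) (X p.1 p.2) / 2)).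
  apply: jet2_sum => p _; have [lp|lp] := boolP (0 < l p.1).
    by have [_ _ _ j] := hA p.2 lp; apply: jet2Z; exact: j.
  have -> : l p.1 = 0 by apply/eqP; rewrite eq_le l0 andbT leNgt.
  rewrite !mul0r => e e0; exists 1 => // s _; rewrite !mul0r !subr0 normr0.
  by rewrite mulr_ge0 ?sqr_ge0// ltW.
have J := jet2D J1 (jet2Z (-1) J2).
have /(jet2_max J)[] : exists2 d : R, 0 < d & forall s, `|s| < d ->
    vt (z + s *: zX) + -1 * (\sum_(p : 'I_n * bool) l p.1 * w p.2 *
      v p.2 (P p.1 p.2 + s *: X p.1 p.2)) <=
    vt (z + 0 *: zX) + -1 * (\sum_(p : 'I_n * bool) l p.1 * w p.2 *
      v p.2 (P p.1 p.2 + 0 *: X p.1 p.2)).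
  have [d d0 hd] : exists2 d : R, 0 < d & forall s : R, `|s| < d ->
      forall p : 'I_n * bool, closure (Om p.2) (P p.1 p.2 + s *: X p.1 p.2).
    apply: finite_eps => p; have [lp|lp] := boolP (0 < l p.1); last first.
      by exists 1 => // s _; rewrite X0// scaler0 addr0.
    have Op := max_gap_interior p.2 hmax gpos lp.
    have [d d0 hd] := open_line_eps (X p.1 p.2) (oO (b := p.2)) Op.
    by exists d => // s /hd; exact: subset_closure.
  exists d => // s /hd hs.
  have cfg' : configuration Om l (fun i b => P i b + s *: X i b).
    by split => // i b; exact: (hs (i, b)).
  have := hm _ _ cfg'; rewrite /gap barycentre_shift -/z -/zX !mean_value_pair.
  rewrite !mulN1r scale0r addr0; congr (_ <= _ - _).
  by apply: eq_bigr => p _; rewrite scale0r addr0.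
rewrite mulN1r => /eqP; rewrite subr_eq0 => /eqP h1.
rewrite mulN1r subr_le0 => h2; split => //.
have -> : \sum_(p : 'I_n * bool) l p.1 * w p.2 * qform (A p.1 p.2) (X p.1 p.2) =
  2 * \sum_(p : 'I_n * bool) l p.1 * w p.2 * (qform (A p.1 p.2) (X p.1 p.2) / 2).
  by rewrite mulr_sumr; apply: eq_bigr => p _; field.
rewrite -/zX; move: (qform At zX) h2 => q h2; lra.
Qed.

Lemma max_gap_gradient i b : 0 < l i -> th i b = tht.
Proof.
move=> li; apply/rowP => j.
pose X := update (fun _ _ => 0) i b (delta_mx 0 j).
have [] := @max_gap_variation X.
  move=> i' b' li'; rewrite /X /update; case: ifP => // /andP[/eqP e _].
  by rewrite e li in li'.
rewrite barycentre_update subr0.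
have -> : barycentre w l (fun _ _ => 0) = 0.
  by rewrite barycentre_pair big1// => p _; rewrite scaler0.
rewrite add0r dotprodZl (bigD1 (i, b))//= big1 ?addr0; last first.
  move=> [i' b'] /=; rewrite -[(_, _) == _]/((i' == i) && (b' == b)).
  by rewrite /X /update => /negbTE ->; rewrite dotprod0l mulr0.
rewrite /X /update !eqxx/= !dotprod_deltal => e _.
by apply: (mulfI _ (esym e)); rewrite gt_eqF// mulr_gt0.
Qed.

(** Split the mass at P i b evenly between P i b + s y and P i b - s y, using the
    slot k of weight 0.  The barycentre does not move, so maximality
    says that v has a nonnegative second difference at P i b. *)
Lemma max_gap_psd k i b : l k = 0 -> 0 < l i -> psd (A i b).
Proof.
move=> lk li; have [cfg hm] := hmax; have [_ l1 lP] := cfg.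
have [As _ _ jets] := hA b li; split => // y.
have ik : k != i by apply: contraTneq li => <-; rewrite lk ltxx.
pose l' j := if (j == i) || (j == k) then l i / 2 else l j.
pose P' (s : R) j c := if j == i then update P i b (P i b + s *: y) i c
  else if j == k then update P i b (P i b - s *: y) i c else P j c.
have split_sum (W : lmodType R) (F F' : 'I_n -> W) :
    (forall j, j != i -> j != k -> F' j = F j) ->
    \sum_j l' j *: F' j = \sum_j l j *: F j +
      (l i / 2) *: (F' i + F' k - 2 *: F i).
  move=> FF; rewrite (bigD1 i)//= [in RHS](bigD1 i)//=.
  rewrite (bigD1 k)//= [X in _ = _ + X + _](bigD1 k)//=.
  rewrite /l' !eqxx orbT lk scale0r add0r/=.
  have -> : \sum_(j | (j != i) && (j != k)) (if (j == i) || (j == k) then l i / 2 else l j) *: F' j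
     = \sum_(j | (j != i) && (j != k)) l j *: F j.
    apply: eq_bigr => j /andP[ji jk]; rewrite (negbTE ji) (negbTE jk)/=.
    by rewrite FF.
  rewrite scalerBr scalerDr scalerA divfK//.
  by rewrite [RHS]addrC [RHS]addrA subrK addrA.
have sum_l' : \sum_j l' j = 1.
  have := @split_sum R^o (fun=> 1) (fun=> 1) (fun _ _ _ => erefl).
  under eq_bigr do rewrite [_ *: _]mulr1.
  move=> ->; rewrite (_ : (1 : R^o) + 1 - 2 *: 1 = 0) ?scaler0 ?addr0.
    by under eq_bigr do rewrite [_ *: _]mulr1.
  by rewrite [2 *: _]mulr1 -(natrD _ 1 1) subrr.
have neqP' s j : j != i -> j != k -> P' s j = P j.
  by move=> ji jk; apply/funext => c; rewrite /P' (negbTE ji) (negbTE jk).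
have bary' s : barycentre w l' (P' s) = barycentre w l P.
  rewrite /barycentre (split_sum _ (fun j => \sum_b w b *: P j b)
    (fun j => \sum_b w b *: P' s j b)); last by move=> j ji jk; rewrite neqP'.
  rewrite (_ : _ + _ - _ = 0) ?scaler0 ?addr0// /P' eqxx (negbTE ik) eqxx.
  rewrite !big_bool /update eqxx/=; apply/rowP => j.
  by case: (b); rewrite /= !mxE; ring.
have mean' s : mean_value w v l' (P' s) = mean_value w v l P +
    l i * w b / 2 * (v b (P i b + s *: y) + v b (P i b + s *: - y) - 2 * v b (P i b)).
  have := @split_sum R^o (fun j => \sum_b w b * v b (P j b))
    (fun j => \sum_b w b * v b (P' s j b)).
  rewrite /mean_value => ->; last by move=> j ji jk; rewrite neqP'.
  congr (_ + _); rewrite /P' eqxx (negbTE ik) eqxx !big_bool /update eqxx/=.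
  rewrite scalerN /GRing.scale/=.
  by case: (b) => /=; move: (v _ _) (v _ _) (v _ _) (v _ _) => *; field.
have Op := max_gap_interior b hmax gpos li.
have [d d0 hd] := open_line_eps y (oO (b := b)) Op.
have J := jet2Z (-1) (jet2D (jets y) (jets (- y))).
have /(jet2_max J)[_] : exists2 d : R, 0 < d & forall s, `|s| < d ->
    -1 * (v b (P i b + s *: y) + v b (P i b + s *: - y)) <=
    -1 * (v b (P i b + 0 *: y) + v b (P i b + 0 *: - y)).
  exists d => // s hs.
  have cfg' : configuration Om l' (P' s).
    split => //.
      by move=> j; rewrite /l'; case: ifP => // _; rewrite divr_ge0// ltW.
    move=> j c; rewrite /P' /update eqxx/=; case: eqP => _.
      by case: eqP => [->|_] //; apply/subset_closure/hd.
    case: eqP => _ //; case: eqP => [->|_] //.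
    by rewrite -scaleNr; apply/subset_closure/hd; rewrite normrN.
  have := hm _ _ cfg'; rewrite /gap bary' mean' !scale0r !addr0 lerD2l lerN2 lerDl.
  by rewrite pmulr_rge0 ?divr_gt0 ?mulr_gt0// => h; lra.
have -> : qform (A i b) (- y) = qform (A i b) y.
  by rewrite /qform linearN/= mulNmx mulmxN mulNmx opprK.
move: (qform _ _) => q; lra.
Qed.

Lemma max_gap_contradiction k : l k = 0 -> False.
Proof.
move=> lk; have [cfg hm] := hmax; have [_ l1 lP] := cfg.
have Tz := gap_pos_interior cfg gpos.
have [Ats hs ht _] := hAt.
have [_ negt _ _] := vT.
have := @sigma2_parallel_sum R ('I_n * bool)%type (fun p => 0 < l p.1)
  (fun p => l p.1 * w p.2) (fun p => - v p.2 (P p.1 p.2))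
  (fun p => A p.1 p.2) tht (- vt (barycentre w l P)) At.
move=> /(_ _ _ _ _ Ats _ hs ht) H.
have : \sum_(p : 'I_n * bool | 0 < l p.1) l p.1 * w p.2 * - v p.2 (P p.1 p.2)
    <= - vt (barycentre w l P).
  apply: H.
  - by move=> p lp; rewrite mulr_gt0.
  - move=> p lp; rewrite oppr_gt0; have [_ neg _ _] := vO p.2; apply: neg.
    exact: max_gap_interior.
  - by move=> p lp; exact: max_gap_psd lk lp.
  - move=> p lp; rewrite -(max_gap_gradient p.2 lp).
    by have [] := hA p.2 lp.
  - by rewrite oppr_gt0; exact: negt.
  move=> f; pose X i b := if 0 < l i then f (i, b) else 0.
  have [] := @max_gap_variation X.
    by move=> i b /negbTE li; rewrite /X li.
  move=> _; rewrite barycentre_pair; congr (qform _ _ <= _).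
    rewrite [RHS]big_mkcond/=; apply: eq_bigr => -[i b] _ /=; rewrite /X.
    by case: ifP; rewrite ?scaler0.
  rewrite [RHS]big_mkcond/=; apply: eq_bigr => -[i b] _ /=; rewrite /X.
  by case: ifP => _ //; rewrite qform0 mulr0.
have : \sum_(p : 'I_n * bool | 0 < l p.1) l p.1 * w p.2 * - v p.2 (P p.1 p.2) =
    - mean_value w v l P.
  rewrite mean_value_pair -sumrN big_mkcond/=; apply: eq_bigr => p _.
  case: ifP => [_|/negbT lp]; first by rewrite mulrN.
  have -> : l p.1 = 0 by apply/eqP; rewrite eq_le l0 andbT leNgt.
  by rewrite !mul0r oppr0.
move=> ->; rewrite lerN2 -subr_le0 leNgt => /negP; apply.
by move: gpos; rewrite /gap.
Qed.

End SecondVariation.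

Lemma max_gap_le0 l P k : max_gap l P -> l k = 0 -> gap l P <= 0.
Proof.
move=> hmax lk; rewrite leNgt; apply/negP => g0.
have [cfg _] := hmax.
have Tz := gap_pos_interior cfg g0.
have [_ _ _ /(_ _ Tz)[tht [At hAt]]] := vT.
have hex (p : 'I_n * bool) : exists d : V * 'M[R]_3,
    0 < l p.1 -> root_jets (v p.2) (P p.1 p.2) d.1 d.2.
  have [lp|_] := boolP (0 < l p.1); last by exists (0, 0).
  have Op := max_gap_interior p.2 hmax g0 lp.
  have [_ _ _ /(_ _ Op)[th [A hA]]] := vO p.2.
  by exists (th, A).
have [d hd] := boolp.choice hex.
apply: (@max_gap_contradiction l P hmax g0 (fun i b => (d (i, b)).1)
  (fun i b => (d (i, b)).2) tht At _ hAt k lk).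
by move=> i b; exact: (hd (i, b)).
Qed.

End MaxPoint.

(** * The comparison theorem *)

(** Five points suffice: among maximal configurations of five pairs of
    points of R^3 there is one with a vanishing weight, by [caratheodory]. *)
Lemma root_comparison (R : realType) (t : R) (A B : set 'rV[R]_3)
    (v0 v1 vt : 'rV[R]_3 -> R) :
  0 < t < 1 -> open A -> open B -> bounded_set A -> bounded_set B ->
  convex_set A -> convex_set B ->
  root_solution A v0 -> root_solution B v1 ->
  root_solution (minkowski_comb t A B) vt -> steep A v0 -> steep B v1 ->
  forall x y, A x -> B y ->
    vt ((1 - t) *: x + t *: y) <= (1 - t) * v0 x + t * v1 y.
Proof.
move=> t01 oA oB bA bB cA cB hA hB hT sA sB x y Ax By.
pose w (b : bool) := if b then t else 1 - t.
pose Om (b : bool) := if b then B else A.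
pose v (b : bool) := if b then v1 else v0.
pose T := minkowski_comb t A B.
have w0 b : 0 < w b by case/andP: t01 => t0 t1; case: b => //=; rewrite subr_gt0.
have oO b : open (Om b) by case: b.
have bO b : bounded_set (Om b) by case: b.
have vO b : root_solution (Om b) (v b) by case: b.
have sO b : steep (Om b) (v b) by case: b.
have oT : open T by exact: minkowski_open.
have cT : convex_set T by exact: minkowski_convex.
have zE (P : bool -> 'rV[R]_3) : \sum_b w b *: P b = (1 - t) *: P false + t *: P true.
  by rewrite big_bool /= addrC.
have inclosure (l : 'I_5 -> R) P : configuration Om l P -> closure T (barycentre w l P).
  move=> [l0 l1 lP]; apply: convex_comb_closure => // i; rewrite zE.
  by apply: minkowski_closure => //; [exact: (lP i false)|exact: (lP i true)].
have interior (l : 'I_5 -> R) P i b : configuration Om l P -> 0 < l i ->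
    Om b (P i b) -> T (barycentre w l P).
  move=> [l0 l1 lP] li Oib.
  apply: (@convex_comb_interior _ _ _ _ _ _ i) => //.
    move=> j; rewrite zE.
    by apply: minkowski_closure => //; [exact: (lP j false)|exact: (lP j true)].
  rewrite zE; case: b Oib => Oib.
    by apply: minkowski_interior_r => //; exact: (lP i false).
  by apply: minkowski_interior_l => //; exact: (lP i true).
pose l0 (i : 'I_5) : R := 5^-1.
pose P0 (i : 'I_5) (b : bool) := if b then y else x.
have l01 : \sum_i l0 i = 1.
  by rewrite /l0 sumr_const card_ord -[LHS]mulr_natl divff.
have cfg0 : configuration Om l0 P0.
  split => [i||i b]; rewrite ?l01 ?invr_ge0//.
  by apply: subset_closure; case: b.
have cv b : {within closure (Om b), continuous (v b)} by have [] := vO b.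
have cvt : {within closure T, continuous vt} by have [] := hT.
have [l [P [cfg hmax]]] := exists_max_gap (v := v) bO cv cvt inclosure
  (ex_intro _ l0 (ex_intro _ P0 cfg0)).
have [cl0 cl1 clP] := cfg.
have [l' [l'0 [k l'k] l'1 l'z l'v]] := caratheodory
  (fun i => \sum_b w b * v b (P i b)) (fun i => \sum_b w b *: P i b) (ltnSn 4) cl0.
have cfg' : configuration Om l' P by split; rewrite ?l'1.
have bE : barycentre w l' P = barycentre w l P by [].
have hmax' : max_gap w Om v vt l' P.
  split => // m Q cfgQ; apply: le_trans (hmax m Q cfgQ) _.
  by rewrite /gap bE lerD2l lerN2.
have := max_gap_le0 w0 oO vO sO hT inclosure interior hmax' l'k.
move=> /(le_trans (hmax'.2 l0 P0 cfg0)); rewrite /gap subr_le0.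
have -> : barycentre w l0 P0 = (1 - t) *: x + t *: y.
  rewrite /barycentre; under eq_bigr do rewrite zE /P0.
  by rewrite -scaler_suml l01 scale1r.
rewrite /mean_value; under eq_bigr do rewrite big_bool /=.
by rewrite -mulr_suml l01 mul1r addrC.
Qed.

Lemma solution_comparison (R : realType) (t : R) (A B : set 'rV[R]_3)
    (u0 u1 ut : 'rV[R]_3 -> R) :
  0 < t < 1 -> C2_plus A -> C2_plus B -> convex_set A -> convex_set B ->
  admissible_solution A u0 -> admissible_solution B u1 ->
  admissible_solution (minkowski_comb t A B) ut ->
  forall x y, A x -> B y ->
    - Num.sqrt (- ut ((1 - t) *: x + t *: y)) <=
    (1 - t) * - Num.sqrt (- u0 x) + t * - Num.sqrt (- u1 y).
Proof.
move=> t01 CA CB cA cB s0 s1 st.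
have [_ oA _ bA _] := CA; have [_ oB _ bB _] := CB.
apply: (@root_comparison _ t A B (fun x => - Num.sqrt (- u0 x))
  (fun x => - Num.sqrt (- u1 x)) (fun x => - Num.sqrt (- ut x))) => //.
- exact: admissible_root_solution.
- exact: admissible_root_solution.
- apply: admissible_root_solution => //; first exact: minkowski_open.
  exact: minkowski_bounded.
- exact: C2_plus_steep.
- exact: C2_plus_steep.
Qed.

Lemma minkowski_self (R : realType) (A : set 'rV[R]_3) : convex_set A ->
  minkowski_comb 2^-1 A A = A.
Proof.
move=> cA; apply/seteqP; split=> [_ [x Ax [y Ay <-]]|x Ax].
  rewrite addrC -[X in A (X + _)]/(2^-1 *: y); apply: convex_comb2 => //.
  by apply/andP; split; lra.
exists x => //; exists x => //; rewrite -scalerDl subrK scale1r//.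
Qed.

(** The comparison for t = 1/2 and equal domains, at x = y; it settles the
    degenerate cases t = 0 and t = 1 of the theorem. *)
Lemma solution_unique_le (R : realType) (A : set 'rV[R]_3) (u u' : 'rV[R]_3 -> R) :
  C2_plus A -> convex_set A -> admissible_solution A u -> admissible_solution A u' ->
  forall x, A x -> - Num.sqrt (- u' x) <= - Num.sqrt (- u x).
Proof.
move=> CA cA su su' x Ax; have h01 : 0 < (2^-1 : R) < 1 by apply/andP; split; lra.
have := @solution_comparison R 2^-1 A A u u u' h01 CA CA cA cA su su.
rewrite minkowski_self// => /(_ su' x x Ax Ax).
by rewrite -scalerDl -mulrDl subrK scale1r mul1r.
Qed.

Lemma minkowski_comb0 (R : realType) (A B : set 'rV[R]_3) : B !=set0 ->
  minkowski_comb 0 A B = A.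
Proof.
move=> [y By]; apply/seteqP; split=> [_ [x Ax [z _ <-]]|x Ax].
  by rewrite subr0 scale1r scale0r addr0.
by exists x => //; exists y => //; rewrite subr0 scale1r scale0r addr0.
Qed.

Lemma minkowski_comb1 (R : realType) (A B : set 'rV[R]_3) : A !=set0 ->
  minkowski_comb 1 A B = B.
Proof.
move=> [x Ax]; apply/seteqP; split=> [_ [z _ [y By <-]]|y By].
  by rewrite subrr scale1r scale0r add0r.
by exists x => //; exists y => //; rewrite subrr scale1r scale0r add0r.
Qed.

Theorem theorem5p1 (R : realType) (Omega0 Omega1 : set 'rV[R]_3) (t : R)
    (u0 u1 ut : 'rV[R]_3 -> R)
    (hC0 : C2_plus Omega0) (hC1 : C2_plus Omega1)
    (hconv0 : convex_set Omega0) (hconv1 : convex_set Omega1)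
    (ht : 0 <= t <= 1)
    (hu0 : admissible_solution Omega0 u0)
    (hu1 : admissible_solution Omega1 u1)
    (hut : admissible_solution (minkowski_comb t Omega0 Omega1) ut) :
  let v0 := fun x => - Num.sqrt (- u0 x) in
  let v1 := fun x => - Num.sqrt (- u1 x) in
  let vtilde := minkowski_comb_fun t Omega0 Omega1 v0 v1 in
  let utilde := fun x => - vtilde x ^+ 2 in
  forall x, minkowski_comb t Omega0 Omega1 x -> ut x <= utilde x.
Proof.
move=> v0 v1 vtilde utilde.
have [nA oA _ bA _] := hC0; have [nB oB _ bB _] := hC1.
have [H ut0] : (forall x y, Omega0 x -> Omega1 y ->
     - Num.sqrt (- ut ((1 - t) *: x + t *: y)) <= (1 - t) * v0 x + t * v1 y) /\
   (forall x, minkowski_comb t Omega0 Omega1 x -> ut x < 0).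
  have [t0|tn0] := eqVneq t 0.
    move: hut; rewrite t0 minkowski_comb0// => hut; split; last exact: solution_lt0 hut.
    move=> x y Ax By; rewrite subr0 scale1r scale0r addr0 mul1r mul0r addr0.
    exact: solution_unique_le hC0 hconv0 hu0 hut _ Ax.
  have [t1|tn1] := eqVneq t 1.
    move: hut; rewrite t1 minkowski_comb1// => hut; split; last exact: solution_lt0 hut.
    move=> x y Ax By; rewrite subrr scale1r scale0r add0r mul1r mul0r add0r.
    exact: solution_unique_le hC1 hconv1 hu1 hut _ By.
  have t01 : 0 < t < 1.
    by case/andP: ht => t0 t1; rewrite !lt_neqAle eq_sym tn0 t0 tn1 t1.
  split; first exact: solution_comparison.
  apply: solution_lt0 hut; first exact: minkowski_open.
  exact: minkowski_bounded.
move=> x Tx; have [x0 Ax [x1 Bx xE]] := Tx; have utx := ut0 x Tx.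
rewrite /utilde /vtilde /minkowski_comb_fun; set S := [set r | _].
have S0 : S ((1 - t) * v0 x0 + t * v1 x1) by exists x0, x1; split.
have lbS : lbound S (- Num.sqrt (- ut x)).
  by move=> r [y0 [y1 [Ay By -> ->]]]; exact: H.
have le_inf : - Num.sqrt (- ut x) <= inf S by apply: lb_le_inf => //; eexists; exact: S0.
have inf_le : inf S <= 0.
  apply: le_trans (ge_inf _ S0) _; first by eexists; exact: lbS.
  case/andP: ht => t0 t1; rewrite /v0 /v1 !mulrN -opprD oppr_le0.
  by rewrite addr_ge0// mulr_ge0 ?sqrtr_ge0// subr_ge0.
have : (- inf S) ^+ 2 <= (Num.sqrt (- ut x)) ^+ 2.
  by rewrite lerXn2r// ?nnegrE ?sqrtr_ge0 ?oppr_ge0// lerNl.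
by rewrite sqrrN sqr_sqrtr ?oppr_ge0 ?(ltW utx)// lerNr.
Qed.
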